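(* Let $(X,D)$ be a metric space and $\rho$ a pseudo-metric on $X$; let $P\subset X$ be a finite set of $n$ points with doubling dimension $d$ (with respect to $D$) and aspect ratio $\Delta$. Let $1\le k'\le k$ be integers, $\alpha>1$, $\epsilon>0$, $C>0$, and let $G$ be the graph constructed by the Diverse Indexing Algorithm (described in the context) with parameters $k,k',\alpha$. Let $q\in X$ and let $\mathsf{OPT}=\{p^*_1,\dots,p^*_k\}\subseteq P$ be a $(k',C)$-diverse set of $k$ points that minimizes $\mathsf{OPT_k}=\max_{p\in\mathsf{OPT}}D(p,q)$. Then the Primal Diverse Search Algorithm (described in the context), run on $G$, $q$ and $C$, finds a $(k',C/12)$-diverse set $\mathsf{ALG}$ of $k$ points with $\mathsf{ALG_k}=\max_{p\in\mathsf{ALG}}D(p,q)\le\left(\frac{\alpha+1}{\alpha-1}+\epsilon\right)\mathsf{OPT_k}$ in $O\left(k\log_\alpha\frac{\Delta}{\epsilon}\right)$ steps, where each step takes $O\left((k^3/k')(8\alpha)^d\log\Delta\right)$ time. The data structure uses space $O\left(n(k/k')(8\alpha)^d\log\Delta\right)$.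
   Context: $B_D(p,r)=\{u\in X: D(u,p)<r\}$ and $B_\rho(p,r)=\{u\in X:\rho(u,p)<r\}$. $P$ has doubling dimension $d$ if for any point $p$ and radius $r$, $B_D(p,2r)\cap P$ can be covered by at most $2^d$ balls of radius $r$. The aspect ratio is $\Delta=D_{max}/D_{min}$ (max and min $D$-distances between distinct points of $P$). A set $S$ is $(k',C)$-diverse if for every $p\in S$, $|B_\rho(p,C)\cap S|\le k'$. Gonzalez greedy algorithm: given a set and a number $m$, pick the first point arbitrarily, then repeatedly (until $m$ points are picked) pick the point whose minimum $\rho$-distance to the already picked points is maximal. Diverse Indexing Algorithm (parameters $k,k',\alpha$): for each $p\in P$: sort all points of $P$ by distance from $p$ into a list $\mathcal{L}$. While $\mathcal{L}$ is nonempty: let $u$ be the point of $\mathcal{L}$ closest to $p$; set $\mathsf{bag}[u]=\{u\}$; for each $v\in\mathcal{L}$ in order, if $D(u,v)\le D(p,u)/(2\alpha)$, add $v$ to $\mathsf{bag}[u]$ and remove $v$ from $\mathcal{L}$; let $\mathsf{rep}[u]$ be $k/k'$ points of $\mathsf{bag}[u]$ chosen by the Gonzalez greedy algorithm; add edges from $p$ to all points of $\mathsf{rep}[u]$; remove $u$ from $\mathcal{L}$. $N_{out}(p)$ denotes the out-neighbors of $p$. Initialization procedure (input $P$, $\rho$, $k,k'$, value $C$): $\mathsf{SOL}=\emptyset$; while there is a point $p$ in the current set $P$ with $|B_\rho(p,C/4)\cap P|>k'$, add an arbitrary $k'$ points of $B_\rho(p,C/4)\cap P$ to $\mathsf{SOL}$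 and remove all points of $B_\rho(p,C/2)$ from $P$; then add all remaining points of $P$ to $\mathsf{SOL}$; if $|\mathsf{SOL}|\ge k$ return an arbitrary $k$-subset of $\mathsf{SOL}$, otherwise return ''no solution''. Primal Diverse Search Algorithm (input $G$, $q$, $C$, number of steps $T$): initialize $\mathsf{ALG}$ as a $(k',C/12)$-diverse set of $k$ points obtained by the initialization procedure. Repeat $T$ times (each is a step): let $U=\bigcup_{p\in\mathsf{ALG}}(N_{out}(p)\cup\{p\})$, sorted by distance from $q$; replace $\mathsf{ALG}$ by its $k-1$ points closest to $q$; for each $u\in U$ in order, if $\mathsf{ALG}\cup\{u\}$ is $(k',C/12)$-diverse, add $u$ to $\mathsf{ALG}$, and stop once $|\mathsf{ALG}|=k$. Return $\mathsf{ALG}$.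
   Formalization: For k=1 the constant in the O(k log_α(Δ/ε)) step bound may depend on a lower bound α0>1 on α and an upper bound ε0 on ε, since no universal constant works there; for k≥2 it is absolute. Logarithms inside O(.) are bounded below by 1, and k/k' is rounded up. *)

(* Defs.v *)
From mathcomp Require Export all_boot all_order all_algebra finmap.
From mathcomp Require Export all_classical all_reals all_analysis.

Set Implicit Arguments.
Unset Strict Implicit.
Unset Printing Implicit Defensive.

Import Order.TTheory GRing.Theory Num.Theory.

Local Open Scope fset_scope.
Local Open Scope ring_scope.

(* The metric D is [mdist]. *)

Section Geometry.
Context {R : realType} {X : metricType R}.
Implicit Types (rho : X -> X -> R) (P S : {fset X}).

Definition pseudometric rho : Prop :=
  [/\ forall x, rho x x = 0, forall x y, rho x y = rho y x
    & forall x y z, rho x z <= rho x y + rho y z].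

(* The dimension is real, and the centres of the balls are arbitrary points of
   the ambient space. *)
Definition doubling_dimension P (d : R) : Prop :=
  forall (p : X) (r : R), 0 < r ->
  exists cs : seq X, (size cs)%:R <= 2 `^ d /\
    forall x, x \in P -> mdist x p < 2 * r -> exists2 c, c \in cs & mdist x c < r.

Definition Dmax P : R :=
  \big[Num.max/0]_(x <- P) \big[Num.max/0]_(y <- P | x != y) mdist x y.

(* [Dmax P] is neutral for the minimum over pairs of distinct points of P. *)
Definition Dmin P : R :=
  \big[Num.min/Dmax P]_(x <- P) \big[Num.min/Dmax P]_(y <- P | x != y) mdist x y.

(* This is 0 by convention when P has fewer than two points. *)
Definition aspect_ratio P : R := Dmax P / Dmin P.

Definition rball rho P (p : X) (r : R) : {fset X} := [fset x in P | rho x p < r].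

Definition diverse rho (k' : nat) (C : R) S : bool :=
  all (fun p => #|` rball rho S p C| <= k')%N S.

(* max_{p in S} D(p, q), for nonempty S *)
Definition max_dist (q : X) S : R := \big[Num.max/0]_(p <- S) mdist p q.

Definition optimal rho (k k' : nat) (C : R) (q : X) P S : Prop :=
  let feasible S' := [/\ S' `<=` P, #|` S'| = k & diverse rho k' C S'] in
  feasible S /\ forall S', feasible S' -> max_dist q S <= max_dist q S'.

End Geometry.

(* The logarithm to base b as it occurs inside O(.): equal to log_b x as soon as
   x >= 2 and log_b x >= 1, and bounded below by 1 otherwise. *)
Definition olog {R : realType} (b x : R) : R :=
  Num.max 1 (ln (Num.max 2 x) / ln b).

Section Indexing.
Context {R : realType} {X : metricType R}.
Variable rho : X -> X -> R.

(* min_{z in s} rho y z; a constant when s is empty, so that the first point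
   picked below is arbitrary *)
Definition rho_to (s : seq X) (y : X) : R :=
  if s is z :: s' then \big[Num.min/rho y z]_(w <- s') rho y w else 0.

(* [gonzalez S m s]: s is a possible sequence of the first m points picked in S
   by the greedy algorithm (ties are broken arbitrarily). *)
Inductive gonzalez (S : seq X) : nat -> seq X -> Prop :=
| gonzalez0 : gonzalez S 0 [::]
| gonzalezS m s x : gonzalez S m s -> x \in S -> x \notin s ->
    (forall y, y \in S -> y \notin s -> rho_to s y <= rho_to s x) ->
    gonzalez S m.+1 (rcons s x).

Definition ceil_div (k k' : nat) : nat := ((k + k').-1 %/ k')%N.

Definition close_to (alpha : R) (p u v : X) : bool :=
  mdist u v <= mdist p u / (2 * alpha).

(* The loop at p on a list sorted by distance from p, whose head u is therefore
   a closest remaining point; the last argument is the list of out-neighbours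
   produced. A bag with fewer than ceil (k / k') points is taken entirely. *)
Inductive bag_loop (k k' : nat) (alpha : R) (p : X) : seq X -> seq X -> Prop :=
| bag_loop_nil : bag_loop k k' alpha p [::] [::]
| bag_loop_cons u L rep out :
    let bag := u :: [seq v <- L | close_to alpha p u v] in
    gonzalez bag (minn (ceil_div k k') (size bag)) rep ->
    bag_loop k k' alpha p [seq v <- L | ~~ close_to alpha p u v] out ->
    bag_loop k k' alpha p (u :: L) (rep ++ out).

(* [G p] is the adjacency list of p. *)
Definition diverse_index (k k' : nat) (alpha : R) (P : {fset X}) (G : X -> seq X)
    : Prop :=
  forall p, p \in P -> exists L : seq X,
    [/\ perm_eq L P, sorted (fun x y => mdist p x <= mdist p y) L
      & bag_loop k k' alpha p L (G p)].

(* number of vertices plus number of entries of the adjacency lists *)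
Definition graph_space (P : {fset X}) (G : X -> seq X) : nat :=
  (\sum_(p <- P) (size (G p)).+1)%N.

End Indexing.

Section Search.
Context {R : realType} {X : metricType R}.
Variables (rho : X -> X -> R) (k k' : nat) (C : R).
Variables (P : {fset X}) (G : X -> seq X) (q : X).

(* [init_loop Q S F]: from the current set of points Q and the current solution
   S, the initialization loop may end with SOL = F. *)
Inductive init_loop : {fset X} -> {fset X} -> {fset X} -> Prop :=
| init_stop Q S : (forall p, p \in Q -> #|` rball rho Q p (C / 4)| <= k')%N ->
    init_loop Q S (S `|` Q)
| init_pick Q S p B F : p \in Q -> (k' < #|` rball rho Q p (C / 4)|)%N ->
    B `<=` rball rho Q p (C / 4) -> #|` B| = k' ->
    init_loop (Q `\` rball rho Q p (C / 2)) (S `|` B) F -> init_loop Q S F.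

(* [None] stands for the answer "no solution". *)
Definition init (o : option {fset X}) : Prop :=
  exists2 F, init_loop P fset0 F &
    if (k <= #|` F|)%N then exists S, [/\ S `<=` F, #|` S| = k & o = Some S]
    else o = None.

Fixpoint fill (A : {fset X}) (s : seq X) : {fset X} :=
  if (k <= #|` A|)%N then A else
  if s is u :: s' then
    fill (if diverse rho k' (C / 12) (u |` A) then u |` A else A) s'
  else A.

Definition step (A B : {fset X}) : Prop :=
  exists (A' : {fset X}) (s : seq X),
    [/\ [/\ A' `<=` A, #|` A'| = k.-1 &
            forall x y, x \in A' -> y \in A `\` A' -> mdist x q <= mdist y q],
        perm_eq s (undup (A ++ flatten [seq G p | p <- A])),
        sorted (fun x y => mdist x q <= mdist y q) s
      & B = fill A' s].

(* [search T o]: o is a possible state after initialization and T steps. *)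
Inductive search : nat -> option {fset X} -> Prop :=
| search_init o : init o -> search 0 o
| search_step T A B : search T (Some A) -> step A B -> search T.+1 (Some B)
| search_fail T : search T None -> search T.+1 None.

End Search.

(* Cost model: the second component counts elementary operations. Each of the
   following costs 1: an evaluation of D or rho, a comparison of two reals or
   two integers, an equality test of two points, access to an adjacency list,
   and every (recursive) call of a function over lists. *)
Definition timed (A : Type) : Type := (A * nat)%type.
Definition ret {A : Type} (x : A) : timed A := (x, 0%N).
Definition op {A : Type} (x : A) : timed A := (x, 1%N).
Definition bind {A B : Type} (m : timed A) (f : A -> timed B) : timed B :=
  let: (x, t) := m in let: (y, t') := f x in (y, (t + t')%N).

Declare Scope timed_scope.
Notation "'let!' x ':=' m 'in' f" := (bind m (fun x => f))
  (at level 200, x name, m at level 100, f at level 200) : timed_scope.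
Notation "m ';;' f" := (bind m (fun _ => f))
  (at level 199, f at level 200, right associativity) : timed_scope.
Local Open Scope timed_scope.

(* An implementation of [step], with its running time. The set ALG is given by a
   duplicate-free list. As a step adds at most one point to the k-1 points it
   keeps, namely a closest one among the points of U that may be added, a linear
   scan of U replaces sorting: the |U| log |U| comparisons of a sort may exceed
   O((k^3/k') (8 alpha)^d log Delta), for instance when k = 1 and d is large. *)
Section TimedStep.
Context {R : realType} {X : metricType R}.
Variables (rho : X -> X -> R) (k' : nat) (C : R) (G : X -> seq X) (q : X).

Definition tick : timed unit := op tt.

(* x is the farthest point from q so far and dx its distance *)
Fixpoint drop_farthest (x : X) (dx : R) (s : seq X) : timed (seq X) :=
  tick ;;
  if s is y :: s' then
    let! dy := op (mdist y q) in
    let! farther := op (dx < dy) in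
    if farther then let! s'' := drop_farthest y dy s' in ret (x :: s'')
    else let! s'' := drop_farthest x dx s' in ret (y :: s'')
  else ret [::].

Fixpoint count_near (u : X) (s : seq X) : timed nat :=
  tick ;;
  if s is y :: s' then
    let! n := count_near u s' in
    let! dyu := op (rho y u) in
    let! near := op (dyu < C / 12) in
    if near then op n.+1 else ret n
  else ret 0%N.

Fixpoint with_counts (A s : seq X) : timed (seq (X * nat)) :=
  tick ;;
  if s is y :: s' then
    let! n := count_near y A in
    let! s'' := with_counts A s' in
    ret ((y, n) :: s'')
  else ret [::].

(* Can u be added to the points listed in s, each of which comes with the number
   of points within C / 12 of it? The number of points near u met so far is n. *)
Fixpoint addable (u : X) (n : nat) (s : seq (X * nat)) : timed bool :=
  tick ;;
  if s is (y, m) :: s' then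
    let! same := op (y == u) in
    if same then ret false else
    let! dyu := op (rho y u) in
    let! near := op (dyu < C / 12) in
    if near then
      let! full := op (k' <= m)%N in
      if full then ret false else addable u n.+1 s'
    else addable u n s'
  else op (n < k')%N.

Fixpoint append (s1 s2 : seq X) : timed (seq X) :=
  tick ;;
  if s1 is x :: s then let! s' := append s s2 in ret (x :: s') else ret s2.

Fixpoint gather (A : seq X) : timed (seq X) :=
  tick ;;
  if A is p :: A' then
    let! nbrs := op (G p) in
    let! U := gather A' in
    let! U' := append nbrs U in
    ret (p :: U')
  else ret [::].

Fixpoint select (B : seq (X * nat)) (best : option (X * R)) (U : seq X)
    : timed (option (X * R)) :=
  tick ;;
  if U is u :: U' then
    let! ok := addable u 0%N B in
    if ok then
      let! du := op (mdist u q) in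
      if best is Some (_, dv) then
        let! closer := op (du < dv) in
        select B (if closer then Some (u, du) else best) U'
      else select B (Some (u, du)) U'
    else select B best U'
  else ret best.

Definition timed_step (A : seq X) : timed (seq X) :=
  if A is x :: s then
    let! dx := op (mdist x q) in
    let! A' := drop_farthest x dx s in
    let! B := with_counts A' A' in
    let! U := gather A in
    let! best := select B None U in
    ret (if best is Some (u, _) then u :: A' else A')
  else ret [::].

End TimedStep.

(* Main.v *)
Require Import Defs.
From mathcomp Require Import zify ring lra.

Set Implicit Arguments.
Unset Strict Implicit.
Unset Printing Implicit Defensive.

Import Order.TTheory GRing.Theory Num.Theory.

Local Open Scope fset_scope.
Local Open Scope ring_scope.

(* Step. Let A be the current solution, x its farthest point from q, r = OPT_k,
   and A' = A \ x. Double counting gives an optimal point o outside A' with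
   fewer than k' points of A' within rho-distance C/2. If o = x then
   D(x, q) <= r; otherwise let p be the point of A closest to o in D. All
   representatives v of the bag of p that contains o satisfy
   D(v, o) <= D(p, o) / alpha, hence lie outside A, and
   D(v, q) <= (D(p, q) + r) / alpha + r. Either one of them is within C/3 of o,
   or, the picks being greedy, there are ceil(k/k') of them at pairwise distance
   at least C/3; in both cases one of them has fewer than k' points of A' within
   C/6 and can be added to A'. So k steps replace a bound m on all distances to
   q by (m + r) / alpha + r, whose fixed point is r (alpha + 1) / (alpha - 1).
   The starting bound is r + Dmax; if k >= 2 then r >= Dmin / 2, while for k = 1
   and r much smaller than Dmin the search ends at the nearest neighbour.

   Space. The centres of the bags of p at distance in [s, lam s) from p are more
   than s / (2 alpha) apart, so that the doubling dimension bounds their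
   number. *)

(** * Packing in doubling metrics *)

Section Packing.
Context {R : realType} {X : metricType R}.
Implicit Types (P : {fset X}) (p x y : X) (us : seq X).

Lemma Dmax_ge0 P : 0 <= Dmax P.
Proof. exact: bigmax_ge_id. Qed.

Lemma mdist_le_Dmax P x y : x \in P -> y \in P -> mdist x y <= Dmax P.
Proof.
move=> xP yP; have [->|nxy] := eqVneq x y; first by rewrite mdistxx Dmax_ge0.
apply: le_trans _ (le_bigmax_seq _ _ _ _ xP isT); exact: le_bigmax_seq.
Qed.

Lemma Dmin_le_mdist P x y :
  x \in P -> y \in P -> x != y -> Dmin P <= mdist x y.
Proof.
move=> xP yP nxy; apply: le_trans (ge_bigmin_seq _ _ _ _ xP isT) _.
exact: ge_bigmin_seq.
Qed.

Lemma Dmin_gt0 P x y : x \in P -> y \in P -> x != y -> 0 < Dmin P.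
Proof.
move=> xP yP nxy.
have Dmax0 : 0 < Dmax P.
  apply: (lt_le_trans _ (mdist_le_Dmax xP yP)); by rewrite mdist_gt0.
rewrite /Dmin; elim/big_ind: _ => // [a b a0 b0|a _]; first by rewrite lt_min a0.
elim/big_ind: _ => // [b c b0 c0|b nab]; first by rewrite lt_min b0.
by rewrite mdist_gt0.
Qed.

Lemma doubling_dimension_ge1 P d p :
  doubling_dimension P d -> p \in P -> 1 <= 2 `^ d.
Proof.
move=> dimP pP; have [cs [sz cov]] := dimP p 1 ltr01.
have [|c csc _] := cov p pP; first by rewrite mdistxx mulr1.
by apply: le_trans sz; rewrite ler1n; case: cs csc {cov}.
Qed.

Lemma doubling_dimension_ge0 P d p :
  doubling_dimension P d -> p \in P -> 0 <= d.
Proof.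
move=> dimP pP; have := doubling_dimension_ge1 dimP pP.
rewrite /powR pnatr_eq0 /= -[leLHS]expR0 ler_expR pmulr_lge0 //.
by apply: ln_gt0; rewrite ltr1n.
Qed.

(** Each halving replaces every ball by 2^d balls of half its radius. The doubling property concerns
    balls around all points of X, so it applies again to the centres found before. *)
Lemma cover_iter P d p r m : doubling_dimension P d -> 0 < r ->
  exists cs : seq X, (size cs)%:R <= (2 `^ d) ^+ m /\
    forall x, x \in P -> mdist x p < 2 ^+ m * r ->
      exists2 c, c \in cs & mdist x c < r.
Proof.
move=> dimP; elim: m r => [|m IH] r r0.
  exists [:: p]; rewrite expr0; split=> // x _.
  by rewrite mul1r => xp; exists p; rewrite ?mem_head.
have [|cs [sz cov]] := IH (2 * r); first by rewrite mulr_gt0.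
have [f Hf] := choice (fun c => dimP c r r0).
exists (flatten [seq f c | c <- cs]); split; last first.
  move=> x xP; rewrite exprSr -mulrA => /(cov x xP) [c ccs xc].
  have [e efc xe] := (Hf c).2 x xP xc.
  by exists e => //; apply/flattenP; exists (f c) => //; apply: map_f.
rewrite exprSr; apply: le_trans (ler_wpM2r (powR_ge0 _ _) sz).
elim: cs {sz cov} => [|c cs IHcs] /=; first by rewrite mul0r.
by rewrite size_cat natrD -addn1 natrD mulrDl mul1r addrC lerD // (Hf c).1.
Qed.

Lemma pairwise_or (T : eqType) (r : rel T) (s : seq T) (x y : T) :
  pairwise r s -> x \in s -> y \in s -> x != y -> r x y || r y x.
Proof.
elim: s => //= z s IH /andP[/allP rz prs]; rewrite !inE.
case/predU1P => [->|xs]; case/predU1P => [->|ys]; rewrite ?eqxx // => nxy.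
- by rewrite rz.
- by rewrite rz // orbT.
- exact: IH.
Qed.

(** By pigeonhole: m halvings of the ball of radius [lam * r] about p give balls so small, since 4
    alpha lam <= 2^m, that two points of the ring in the same one would be close. So each ball
    contains at most one point of [us]. *)
Lemma ring_packing P d p alpha r lam m us :
  doubling_dimension P d -> 0 < alpha -> 0 < r -> 0 < lam ->
  4 * alpha * lam <= 2 ^+ m -> {subset us <= P} ->
  pairwise (fun u v => ~~ close_to alpha p u v) us ->
  all (fun u => r <= mdist p u < lam * r) us ->
  (size us)%:R <= (2 `^ d) ^+ m.
Proof.
move=> dimP a0 r0 l0 alm usP pw /allP ring.
have m0 : 0 < 2 ^+ m :> R by rewrite exprn_gt0.
have s0 : 0 < lam * r / 2 ^+ m by rewrite divr_gt0 // mulr_gt0.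
have [cs [sz cov]] := cover_iter p m dimP s0.
apply: le_trans sz; rewrite ler_nat.
have /choice[f Hf] x :
    exists c, x \in us -> c \in cs /\ mdist x c < lam * r / 2 ^+ m.
  case: (boolP (x \in us)) => [xus|_]; last by exists p.
  have [|c ccs xc] := cov x (usP x xus); last by exists c.
  rewrite metric_sym mulrC divfK ?gt_eqF //.
  by have /andP[] := ring x xus.
have uus : uniq us.
  apply: pairwise_uniq pw => x; rewrite /close_to mdistxx.
  by rewrite divr_ge0 ?mdist_ge0 ?mulr_ge0 ?ltW.
rewrite -(size_map f); apply: uniq_leq_size; last first.
  by move=> _ /mapP[x xus ->]; exact: (Hf x xus).1.
rewrite map_inj_in_uniq // => x y xus yus fxy.
apply/eqP; apply: contraT => nxy.
have xy : mdist x y <= r / (2 * alpha).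
  have [_ xc] := Hf x xus; have [_ yc] := Hf y yus.
  apply: le_trans (metric_triangle x (f x) y) _.
  rewrite [mdist (f x) y]metric_sym {2}fxy.
  apply: le_trans (lerD (ltW xc) (ltW yc)) _.
  have half : lam * r / 2 ^+ m <= r / (2 * alpha) / 2.
    rewrite ler_pdivrMr //.
    have -> : r / (2 * alpha) / 2 * 2 ^+ m = r * 2 ^+ m / (4 * alpha).
      by field; rewrite gt_eqF.
    rewrite ler_pdivlMr ?mulr_gt0 //.
    have -> : lam * r * (4 * alpha) = r * (4 * alpha * lam) by ring.
    by rewrite ler_pM2l.
  by lra.
have close u v : u \in us -> mdist u v <= r / (2 * alpha) -> close_to alpha p u v.
  move=> uus' uv; apply: le_trans uv _; rewrite ler_pM2r ?invr_gt0 ?mulr_gt0 //.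
  by have /andP[] := ring u uus'.
by have := pairwise_or pw xus yus nxy; rewrite !close //= metric_sym.
Qed.

(** The points other than p are at distance between Dmin and Dmax from p, a range exhausted by n
    rings of ratio [lam] starting at Dmin; [ring_packing] bounds each ring. *)
Lemma centers_count P d p alpha lam m n us :
  doubling_dimension P d -> 0 < alpha -> 1 < lam -> 0 < Dmin P ->
  4 * alpha * lam <= 2 ^+ m -> p \in P -> {subset us <= P} ->
  pairwise (fun u v => ~~ close_to alpha p u v) us ->
  all (fun u => p != u) us -> Dmax P < Dmin P * lam ^+ n ->
  (size us)%:R <= n%:R * (2 `^ d) ^+ m.
Proof.
move=> dimP a0 l1 D0 alm pP usP pw /allP pus Dn.
have l0 : 0 < lam by apply: lt_trans l1.
have main j : (count (fun u => mdist p u < Dmin P * lam ^+ j) us)%:R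
    <= j%:R * (2 `^ d) ^+ m :> R.
  elim: j => [|j IH].
    rewrite mul0r lern0.
    have -> : count (fun u => mdist p u < Dmin P * lam ^+ 0)%R us = count pred0 us.
      apply: eq_in_count => u uus /=; apply/negbTE; rewrite -leNgt expr0 mulr1.
        exact: Dmin_le_mdist pP (usP u uus) (pus u uus).
    by rewrite count_pred0.
  set far := [seq u <- us |
    Dmin P * lam ^+ j <= mdist p u < lam * (Dmin P * lam ^+ j)].
  have split_count : (count (fun u => mdist p u < Dmin P * lam ^+ j.+1)%R us <=
      count (fun u => mdist p u < Dmin P * lam ^+ j)%R us + size far)%N.
    rewrite size_filter -count_predUI; apply: leq_trans (leq_addr _ _).
    apply: sub_count => u /=; rewrite exprS mulrCA => ->.
    by rewrite andbT; case: ltP.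
  apply: le_trans (_ : _ <= (_ + size far)%:R) _.
    by rewrite ler_nat; exact: split_count.
  rewrite natrD -addn1 natrD mulrDl mul1r lerD //.
  apply: (ring_packing (p := p) (r := Dmin P * lam ^+ j) dimP a0 _ l0 alm) => //.
  - by rewrite mulr_gt0 // exprn_gt0.
  - by move=> x; rewrite mem_filter => /andP[_ /usP].
  - exact: pairwise_filter.
  - exact: filter_all.
apply: le_trans (main n); rewrite ler_nat -(@count_predT _ us).
apply: eq_leq; apply: eq_in_count => u uus /=.
by rewrite (le_lt_trans (mdist_le_Dmax pP (usP u uus)) Dn).
Qed.

End Packing.

(** * Choice of the ring ratio and number of rings *)

Section Scales.
Context {R : realType}.
Implicit Types (alpha d x y lam : R).

Lemma ln2_gt0 : 0 < ln 2 :> R.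
Proof. by apply: ln_gt0; rewrite ltr1n. Qed.

(** From exp(-1/2) >= 1 - 1/2 follows exp(1/2) <= 2, which is then squared. *)
Lemma expR1_le4 : expR 1 <= 4 :> R.
Proof.
have e0 := expR_gt0 (- (2^-1) : R).
have := expR_ge1Dx (- (2^-1) : R) => e1.
have -> : expR 1 = (expR (- (2^-1)))^-1 * (expR (- (2^-1)))^-1 :> R.
  by rewrite -expRN opprK -expRD; congr expR; lra.
have e2 : (expR (- (2^-1)))^-1 <= 2 :> R.
  by rewrite -[leRHS]invrK lef_pV2 ?posrE //; lra.
by have := invr_gt0 (expR (- (2^-1) : R)); rewrite e0 => e3; nra.
Qed.

Lemma olog_ge1 b x : 1 <= olog b x.
Proof. by rewrite /olog le_max lexx. Qed.

Lemma ln_max2_ge b x : 1 < b -> ln (Num.max 2 x) <= ln b * olog b x.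
Proof.
move=> b1; rewrite mulrC -ler_pdivrMr ?ln_gt0 //.
by rewrite /olog le_max lexx orbT.
Qed.

Lemma exists_expr_gt lam x : 1 < lam -> 1 <= x ->
  exists n, x < lam ^+ n /\ n%:R <= ln x / ln lam + 1.
Proof.
move=> l1 x1; have l0 : 0 < ln lam by apply: ln_gt0.
have q0 : 0 <= ln x / ln lam by rewrite divr_ge0 ?ln_ge0 // ltW.
have /andP[qn nq] := truncn_itv q0.
exists (Num.truncn (ln x / ln lam)).+1; split; last by rewrite -addn1 natrD lerD2r.
have lam0 : 0 < lam by apply: lt_trans l1.
rewrite -ltr_ln ?posrE ?exprn_gt0 //; last exact: lt_le_trans x1.
by rewrite lnXn // -mulr_natl -ltr_pdivrMr.
Qed.

Lemma rings_number lam Delta : 1 < lam -> exists n : nat,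
  Delta < lam ^+ n /\ n%:R <= (ln 2 / ln lam + 1) * olog 2 Delta.
Proof.
move=> l1; have l0 : 0 < ln lam by apply: ln_gt0.
(* Raising Delta to at least 2 keeps the logarithm nonnegative and matches [olog]. *)
have M1 : 1 <= Num.max 2 Delta by rewrite le_max ler1n.
have [n [Mn nM]] := exists_expr_gt l1 M1.
exists n; split; first by apply: le_lt_trans Mn; rewrite le_max lexx orbT.
apply: le_trans nM _; rewrite mulrDl mul1r; apply: lerD; last exact: olog_ge1.
rewrite mulrAC ler_pM2r ?invr_gt0 //; apply: ln_max2_ge.
by rewrite ltr1n.
Qed.

(* A ring of ratio [lam] needs m halvings, where 4 alpha lam <= 2^m. Taking
   lam = 2 and rounding up the number of halvings costs a factor tau^d, where
   tau = 2^m / (8 alpha) is in (1, 2]; with one halving less, lam has to be tau,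
   and there are about 1 / ln tau rings per doubling. For every d, one of the two
   choices loses only a constant factor. *)
Lemma packing_scale alpha d Delta : 1 < alpha -> 0 <= d ->
  exists m n lam, [/\ 1 < lam, 4 * alpha * lam <= 2 ^+ m, Delta < lam ^+ n
    & n%:R * (2 `^ d) ^+ m <= 8 * (8 * alpha) `^ d * olog 2 Delta].
Proof.
move=> a1 d0; have a0 : 0 < alpha by apply: lt_trans a1.
have A1 : 1 <= 8 * alpha by lra.
have A0 : 0 < 8 * alpha by lra.
have L0 := ln2_gt0.
have q0 : 0 <= ln (8 * alpha) / ln 2 by rewrite divr_ge0 ?ln_ge0 ?ler1n.
have /andP[] := truncn_itv q0; set m := Num.truncn _.
rewrite ler_pdivlMr // ltr_pdivrMr // => mq qm.
have pow2 j : (2 `^ d) ^+ j = expR (d * (j%:R * ln 2)).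
  by rewrite /powR pnatr_eq0 /= -expRM_natl mulrCA.
have powA : (8 * alpha) `^ d = expR (d * ln (8 * alpha)).
  by rewrite /powR gt_eqF.
have exp2 j : 2 ^+ j = expR (j%:R * ln 2) :> R.
  by rewrite expRM_natl lnK // posrE.
(* [y] is ln tau; the rounded-up number of halvings is [m.+1], and [m] is one less. *)
set y := m.+1%:R * ln 2 - ln (8 * alpha).
have y0 : 0 < y by rewrite subr_gt0.
have yL : y <= ln 2 by rewrite /y -addn1 natrD mulrDl mul1r; lra.
have o1 := olog_ge1 2 Delta; have o0 : 0 < olog 2 Delta by apply: lt_le_trans o1.
(* If tau^d <= e, rounding up loses only a constant factor; otherwise the rings get ratio tau. *)
case: (lerP (d * y) 1) => [dy|dy].
- have [n [Dn nM]] := @rings_number 2 Delta ltac:(by rewrite ltr1n).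
  exists m.+1, n, 2; split=> //; first by rewrite ltr1n.
    rewrite (_ : 4 * alpha * 2 = 8 * alpha); last by ring.
    by rewrite exp2 -[leLHS]lnK ?posrE // ler_expR ltW.
  have p4 : (2 `^ d) ^+ m.+1 <= 4 * (8 * alpha) `^ d.
    rewrite pow2 powA (_ : m.+1%:R * ln 2 = y + ln (8 * alpha)); last by rewrite subrK.
    rewrite mulrDr expRD ler_pM2r ?expR_gt0 //.
    by apply: le_trans expR1_le4; rewrite ler_expR.
  rewrite divff ?gt_eqF // in nM.
  apply: le_trans (ler_pM _ _ nM p4) _; rewrite ?ler0n ?exprn_ge0 ?powR_ge0 //.
  by rewrite le_eqVlt; apply/orP; left; apply/eqP; ring.
- have tau1 : 1 < expR y by rewrite expR_gt1.
  have [n [Dn nM]] := rings_number Delta tau1.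
  exists m, n, (expR y); split=> //.
    rewrite /y expRB -exp2 lnK ?posrE // exprS.
    have halve z : 4 * alpha * (2 * z / (8 * alpha)) = z.
      by field; rewrite gt_eqF.
    by rewrite halve.
  rewrite expRK in nM.
  (* The factor (tau / 2)^d saved by one halving less pays for the extra rings: for y < (ln 2) / 2
     it is at most 1 / (1 + d (ln 2) / 2), while d y > 1 gives (ln 2) / y <= d ln 2. *)
  have ratio : (ln 2 / y + 1) * expR (d * (y - ln 2)) <= 8.
    have E0 := expR_gt0 (d * (y - ln 2)).
    case: (lerP (ln 2 / 2) y) => yh.
      have E1 : expR (d * (y - ln 2)) <= 1.
        by rewrite expR_le1 mulr_ge0_le0 // subr_le0.
      have q3 : ln 2 / y <= 2 by rewrite ler_pdivrMr //; lra.
      have q00 : 0 <= ln 2 / y by rewrite divr_ge0 // ltW.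
      by nra.
    rewrite -[y - _]opprB mulrN expRN ler_pdivrMr ?expR_gt0 //.
    have : expR (d * (ln 2 / 2)) <= expR (d * (ln 2 - y)).
      by rewrite ler_expR ler_wpM2l //; lra.
    have := expR_ge1Dx (d * (ln 2 / 2)).
    have : ln 2 / y <= d * ln 2.
      by rewrite ler_pdivrMr // -mulrA (mulrC (ln 2)) mulrA ler_peMl // ltW.
    have : 0 <= d * ln 2 by rewrite mulr_ge0 // ltW.
    lra.
  have -> : (2 `^ d) ^+ m = (8 * alpha) `^ d * expR (d * (y - ln 2)).
    rewrite pow2 powA -expRD -mulrDr; congr (expR (d * _)).
    by rewrite /y -[m.+1]addn1 natrD; ring.
  apply: le_trans (ler_wpM2r _ nM) _; first by rewrite mulr_ge0 ?powR_ge0 ?expR_ge0.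
  move: (ln 2 / y + 1) (expR _) ratio => r E ratio.
  have -> : r * olog 2 Delta * ((8 * alpha) `^ d * E) =
    r * E * ((8 * alpha) `^ d * olog 2 Delta) by ring.
  by rewrite -[leRHS]mulrA ler_wpM2r // mulr_ge0 ?powR_ge0 // ltW.
Qed.

End Scales.

(** * The index *)

Section Index.
Context {R : realType} {X : metricType R}.
Variable rho : X -> X -> R.
Hypothesis rhoP : pseudometric rho.
Implicit Types (p u v z : X) (L out rep us : seq X).

Lemma rho_to_ge s y c : s != [::] ->
  (c <= rho_to rho s y) = all (fun w => c <= rho y w) s.
Proof.
case: s => // z s _; rewrite /= andbC.
elim: s => [|w s IH] /=; first by rewrite big_nil.
by rewrite big_cons le_min IH andbA.
Qed.

Lemma gonzalez_size S m s : gonzalez rho S m s -> size s = m.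
Proof. by elim=> // {}m {}s x _ IH _ _ _; rewrite size_rcons IH. Qed.

Lemma gonzalez_uniq S m s : gonzalez rho S m s -> uniq s.
Proof. by elim=> // {}m {}s x _ IH _ nx _; rewrite rcons_uniq nx IH. Qed.

Lemma gonzalez_sub S m s : gonzalez rho S m s -> {subset s <= S}.
Proof.
elim=> // {}m {}s x _ IH xS _ _ y; rewrite mem_rcons inE.
by case/predU1P => [->|/IH].
Qed.

Lemma gonzalez_full S m s : gonzalez rho S m s -> uniq S -> size S = m ->
  {subset S <= s}.
Proof.
move=> gS uS mS x; have sS := gonzalez_sub gS.
have [|_ ->//] := uniq_min_size (gonzalez_uniq gS) sS.
by rewrite (gonzalez_size gS) mS.
Qed.

(* Every pick is at least as far from the previous ones as z is. *)
Lemma gonzalez_separated S m s z c : gonzalez rho S m s -> z \in S ->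
  (forall v, v \in s -> c <= rho z v) -> z \notin s ->
  pairwise (fun v w => c <= rho v w) s.
Proof.
have [_ rhoC _] := rhoP.
elim=> // {}m {}s x gs IH xS nx far zS zfar.
rewrite mem_rcons inE negb_or => /andP[_ zs].
rewrite pairwise_rcons IH // ?andbT; last first.
  by move=> v vs; apply: zfar; rewrite mem_rcons inE vs orbT.
have [->//|s0] := eqVneq s [::].
have : c <= rho_to rho s x.
  apply: le_trans (far z zS zs); rewrite rho_to_ge //; apply/allP => w ws.
  by apply: zfar; rewrite mem_rcons inE ws orbT.
by rewrite rho_to_ge // => /allP H; apply/allP => w /H; rewrite rhoC.
Qed.

Section Loop.
Variables (k k' : nat) (alpha : R).

Lemma bag_loop_sub p L out : bag_loop rho k k' alpha p L out ->
  {subset out <= L}.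
Proof.
elim=> // u {}L rep {}out bag /gonzalez_sub grep _ IH x.
rewrite mem_cat inE => /orP[/grep|/IH].
  by rewrite inE mem_filter => /orP[->//|/andP[_ ->]]; rewrite orbT.
by rewrite mem_filter => /andP[_ ->]; rewrite orbT.
Qed.

(** The centres are the successive heads [u]: a later one has survived the filter of every earlier
    one, and each contributes at most ceil(k/k') edges. *)
Lemma bag_loop_centers p L out : bag_loop rho k k' alpha p L out ->
  exists us, [/\ {subset us <= L},
    pairwise (fun u v => ~~ close_to alpha p u v) us
    & (size out <= ceil_div k k' * size us)%N].
Proof.
elim=> [|u {}L rep {}out bag /gonzalez_size grep _ [us [usL pus sz]]].
  by exists [::].
exists (u :: us); split.
- move=> x; rewrite !inE => /predU1P[->|/usL]; first by rewrite eqxx.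
  by rewrite mem_filter => /andP[_ ->]; rewrite orbT.
- rewrite /= pus andbT; apply/allP => x /usL.
  by rewrite mem_filter => /andP[].
- by rewrite size_cat grep mulnS leq_add // geq_minl.
Qed.

(** At the iteration that moves z into a bag, the head u is a closest remaining point of the sorted
    list, hence no farther from p than z. *)
Lemma bag_loop_bag p L out z : 0 < alpha -> bag_loop rho k k' alpha p L out ->
  uniq L -> sorted (fun x y => mdist p x <= mdist p y) L -> z \in L ->
  exists u bag rep, [/\ mdist p u <= mdist p z, uniq bag & z \in bag] /\
    [/\ forall v, v \in bag -> mdist u v <= mdist p u / (2 * alpha),
      gonzalez rho bag (minn (ceil_div k k') (size bag)) rep
    & {subset rep <= out}].
Proof.
have tr : transitive (fun x y : X => mdist p x <= mdist p y).
  by move=> y x t; apply: le_trans.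
move=> a0; elim=> // u {}L rep {}out bag grep _ IH /andP[uL UL] sL zL.
have uP v : v \in u :: L -> mdist p u <= mdist p v.
  have := order_path_min tr sL => /allP minu.
  by rewrite inE => /predU1P[->//|/minu].
case: (boolP (z \in bag)) => zb.
  exists u, bag, rep; split; split=> //.
  - exact: uP.
  - by rewrite cons_uniq mem_filter (negbTE uL) andbF filter_uniq.
  - move=> v; rewrite inE mem_filter => /predU1P[->|/andP[]] //.
    by rewrite mdistxx divr_ge0 ?mdist_ge0 ?mulr_ge0 ?ltW.
  - by move=> x xr; rewrite mem_cat xr.
have [||| u' [bag' [rep' [H [H1 H2 H3]]]]] := IH; first exact: filter_uniq.
- by apply: (sorted_filter tr); apply: path_sorted sL.
- move: zL zb; rewrite !inE !mem_filter.
  by case: (z == u) => //= ->; rewrite !andbT.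
exists u', bag', rep'; split=> //; split=> // x xr.
by rewrite mem_cat H3 ?orbT.
Qed.

End Loop.

Lemma ceil_div_mul k k' : (0 < k')%N -> (k <= ceil_div k k' * k')%N.
Proof.
move=> k0; rewrite /ceil_div.
have := divn_eq (k + k').-1 k'; have := ltn_pmod (k + k').-1 k0; lia.
Qed.

(** Rounding up adds less than 1, and 1 <= k/k'; hence the factor 2. *)
Lemma ceil_div_le k k' : (0 < k')%N -> (k' <= k)%N ->
  (ceil_div k k')%:R <= 2 * (k%:R / k'%:R) :> R.
Proof.
move=> k0 kk; rewrite mulrA ler_pdivlMr ?ltr0n // -!natrM ler_nat /ceil_div.
apply: leq_trans (leq_trunc_div _ _) _; lia.
Qed.

(** There are at most 9 V bags: 8 V for the centres other than p, at the scale of [packing_scale],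
    and one for p, which is at distance 0 and lies in no ring. Rounding k/k' up doubles this to
    18. *)
Lemma degree_bound (P : {fset X}) (G : X -> seq X) k k' alpha d p :
  doubling_dimension P d -> (0 < k')%N -> (k' <= k)%N -> 1 < alpha ->
  diverse_index rho k k' alpha P G -> p \in P ->
  (size (G p))%:R <=
    18 * (k%:R / k'%:R) * (8 * alpha) `^ d * olog 2 (aspect_ratio P).
Proof.
move=> dimP k0 kk a1 idx pP; have a0 : 0 < alpha by apply: lt_trans a1.
have [L [LP _ /bag_loop_centers[us [usL pus sz]]]] := idx p pP.
have usP : {subset us <= P} by move=> x /usL; rewrite (perm_mem LP).
set V := (8 * alpha) `^ d * olog 2 (aspect_ratio P).
have d0 := doubling_dimension_ge0 dimP pP.
have V1 : 1 <= V.
  rewrite -[leLHS]mulr1 ler_pM // ?olog_ge1 //.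
  by rewrite -[leLHS](powRr0 (8 * alpha)) ler_powR //; lra.
have szus : (size us)%:R <= 9 * V.
  set us' := [seq u <- us | p != u].
  have uus : (size us <= 1 + size us')%N.
    rewrite -(count_predC (fun u => p == u)) -size_filter leq_add //.
      have uus : uniq us.
        apply: pairwise_uniq pus => x; rewrite /close_to mdistxx.
        by rewrite divr_ge0 ?mdist_ge0 ?mulr_ge0 ?ltW.
      rewrite size_filter (eq_count (a2 := pred1 p)); last by move=> u; rewrite /= eq_sym.
      by rewrite count_uniq_mem //; case: (_ \in _).
    by rewrite size_filter.
  have us'P : {subset us' <= P} by move=> x; rewrite mem_filter => /andP[_ /usP].
  have pus' : pairwise (fun u v => ~~ close_to alpha p u v) us'.
    exact: pairwise_filter.
  have nus' : all (fun u => p != u) us' by exact: filter_all.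
  have szus' : (size us')%:R <= 8 * V.
    (* A centre other than p is what makes Dmin positive. *)
    case us'E : us' => [|x s]; first by rewrite mulr_ge0 // (le_trans _ V1).
    rewrite -us'E.
    have D0 : 0 < Dmin P.
      apply: (@Dmin_gt0 _ _ P p x) => //; first by apply: us'P; rewrite us'E mem_head.
      by move: nus'; rewrite us'E /= => /andP[].
    have [m [n [lam [l1 alm Dn num]]]] := packing_scale (aspect_ratio P) a1 d0.
    rewrite /V mulrA; apply: le_trans num.
    apply: (centers_count (P := P) (p := p) dimP a0 l1 D0 alm) => //.
    by rewrite mulrC -ltr_pdivrMr.
  apply: le_trans (_ : 1 + 8 * V <= _); last lra.
  apply: le_trans (_ : (1 + size us')%:R <= _); first by rewrite ler_nat.
  by rewrite natrD lerD2l.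
apply: le_trans (_ : (ceil_div k k' * size us)%:R <= _); first by rewrite ler_nat.
rewrite natrM; apply: le_trans (ler_pM _ _ (ceil_div_le k0 kk) szus) _ => //.
by rewrite /V le_eqVlt; apply/orP; left; apply/eqP; ring.
Qed.

End Index.

(** * Diverse sets *)

Lemma seq_argmin {R : realType} (T : eqType) (f : T -> R) (s : seq T) x :
  x \in s -> exists2 y, y \in s & forall z, z \in s -> f y <= f z.
Proof.
elim: s x => // x [|t s] IH _ _.
  by exists x; rewrite ?mem_head // => z; rewrite inE => /eqP->.
have [|y ys ymin] := IH t; first exact: mem_head.
have [xy|yx] := lerP (f x) (f y).
  exists x; first exact: mem_head.
  by move=> z; rewrite inE => /predU1P[->//|/ymin]; apply: le_trans.
exists y; first by rewrite inE ys orbT.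
by move=> z; rewrite inE => /predU1P[->|/ymin//]; apply: ltW.
Qed.

Lemma fset_take (T : choiceType) (A : {fset T}) n : (n <= #|` A|)%N ->
  exists2 B, B `<=` A & #|` B| = n.
Proof.
move=> nA; exists [fset x in take n A].
  by apply/fsubsetP => x; rewrite !inE => /mem_take.
by rewrite card_fseq undup_id ?take_uniq ?fset_uniq // size_takel.
Qed.

Lemma perm_fset1U (T : choiceType) (x : T) (A : {fset T}) :
  x \notin A -> perm_eq (x |` A) (x :: A).
Proof.
move=> xA; apply: uniq_perm; rewrite /= ?fset_uniq ?xA // => y.
by rewrite !inE.
Qed.

Section Diversity.
Context {R : realType} {X : metricType R}.
Variable rho : X -> X -> R.
Hypothesis rhoP : pseudometric rho.
Implicit Types (p x y z v : X) (S Q A B F O P : {fset X}) (r C : R).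

Let rho_xx x : rho x x = 0. Proof. by have [->] := rhoP. Qed.
Let rhoC x y : rho x y = rho y x. Proof. by have [_ ->] := rhoP. Qed.
Let rho_tri x y z : rho x z <= rho x y + rho y z.
Proof. by have [_ _] := rhoP; apply. Qed.

Lemma in_rball S p r x : (x \in rball rho S p r) = (x \in S) && (rho x p < r).
Proof. by rewrite /rball !inE. Qed.

Lemma card_rball S p r : #|` rball rho S p r| = count (fun x => rho x p < r) S.
Proof.
rewrite -size_filter; apply: perm_size.
apply: uniq_perm => [||x]; rewrite ?fset_uniq ?filter_uniq ?fset_uniq //.
by rewrite in_rball mem_filter andbC.
Qed.

Lemma card_rball_le S S' p p' r r' :
  (forall x, x \in S -> rho x p < r -> x \in S' /\ rho x p' < r') ->
  (#|` rball rho S p r| <= #|` rball rho S' p' r'|)%N.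
Proof.
move=> H; apply/fsubset_leq_card/fsubsetP => x; rewrite !in_rball.
by move=> /andP[xS xr]; have [-> ->] := H x xS xr.
Qed.

Lemma diverseP k' C S :
  reflect (forall p, p \in S -> #|` rball rho S p C| <= k')%N (diverse rho k' C S).
Proof. exact: allP. Qed.

Lemma diverse_sub k' C C' S S' : S' `<=` S -> C' <= C ->
  diverse rho k' C S -> diverse rho k' C' S'.
Proof.
move=> /fsubsetP SS CC /diverseP dS; apply/diverseP => p /SS pS.
apply: leq_trans (dS p pS); apply: card_rball_le => x /SS xS xp; split=> //.
exact: lt_le_trans CC.
Qed.

(** * Initialization *)

Section Init.
Variables (k' : nat) (C : R).
Hypothesis C0 : 0 < C.

(** As C > 0, the chosen p lies in the ball that is removed, so the current set shrinks and the loop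
    ends. *)
Lemma init_loop_exists Q S : exists F, init_loop rho k' C Q S F.
Proof.
have [n] := ubnP #|` Q|; elim: n Q S => // n IH Q S; rewrite ltnS => Qn.
have [/allP small|] := boolP (all (fun p => #|` rball rho Q p (C / 4)| <= k')%N Q).
  by exists (S `|` Q); apply: init_stop.
case/allPn => p pQ; rewrite -ltnNge => big.
have [B Bb Bk] := fset_take (ltnW big).
have [|F HF] := IH (Q `\` rball rho Q p (C / 2)) (S `|` B).
  apply: leq_trans Qn; apply: fproper_ltn_card.
  rewrite fproperE fsubsetDl; apply/fsubsetPn; exists p => //.
  by rewrite in_fsetD in_rball pQ rho_xx divr_gt0.
by exists F; apply: init_pick Bk HF.
Qed.

Lemma init_loop_sub Q S F : init_loop rho k' C Q S F -> F `<=` S `|` Q.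
Proof.
elim=> {}Q {}S // p B {}F pQ _ Bb _ _ IH.
apply: fsubset_trans IH _; rewrite !fsubUset fsubsetUl /=.
rewrite (fsubset_trans Bb) ?(fsubset_trans (fsubsetDl _ _)) ?fsubsetUr //.
by apply: fsubset_trans (fset_sub _ _) (fsubsetUr _ _).
Qed.

(** Loop invariant: S is diverse, at distance at least C/4 from the remaining points Q, and as large
    as the part of O already removed. A pick adds k' points within C/4 of p and removes all points
    within C/2, so what remains is C/2 - C/4 away from them. *)
Lemma init_loop_spec O Q S F : init_loop rho k' C Q S F ->
  diverse rho k' C O -> (#|` O `\` Q| <= #|` S|)%N ->
  (forall s x, s \in S -> x \in Q -> C / 4 <= rho x s) ->
  diverse rho k' (C / 4) S ->
  diverse rho k' (C / 4) F /\ (#|` O| <= #|` F|)%N.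
Proof.
move=> loop dO; elim: loop => {}Q {}S => [small OS sep /diverseP dS|].
  split.
    apply/diverseP => p; rewrite inE => /orP[pS|pQ].
      apply: leq_trans (dS p pS); apply: card_rball_le => x.
      by case/fsetUP => [//|xQ]; rewrite ltNge sep.
    apply: leq_trans (small p pQ); apply: card_rball_le => x.
    by case/fsetUP => [xS|//]; rewrite rhoC ltNge sep.
  have dis : S `&` Q = fset0.
    apply/fsetP => x; rewrite !inE; apply/negbTE/andP => -[xS xQ].
    by have := sep x x xS xQ; rewrite rho_xx leNgt divr_gt0.
  have := cardfsUI S Q; rewrite dis cardfs0 addn0 => ->.
  by rewrite -(cardfsID Q O) addnC leq_add // fsubset_leq_card // fsubsetIr.
move=> p B {}F pQ big Bb Bk _ IH OS sep /diverseP dS.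
have BQ x : x \in B -> x \in Q /\ rho x p < C / 4.
  by move/(fsubsetP Bb); rewrite in_rball => /andP[].
have SB : S `&` B = fset0.
  apply/fsetP => x; rewrite !inE; apply/negbTE/andP => -[xS /BQ[xQ _]].
  by have := sep x x xS xQ; rewrite rho_xx leNgt divr_gt0.
apply: IH.
- have := cardfsUI S B; rewrite SB cardfs0 addn0 => ->; rewrite Bk.
  (* Points of the removed ball are less than C apart, so the diversity of O around any one of its
     points there bounds how many it loses. *)
  have near : (#|` O `&` rball rho Q p (C / 2)| <= k')%N.
    have [->|/fset0Pn[ o]] := eqVneq (O `&` rball rho Q p (C / 2)) fset0.
      by rewrite cardfs0.
    rewrite !inE => /andP[oO /andP[_ op]].
    apply: leq_trans (diverseP _ _ _ dO o oO).
    apply/fsubset_leq_card/fsubsetP => x; rewrite !inE => /andP[-> /andP[_ xp]] /=.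
    by have := rho_tri x p o; rewrite (rhoC p o); lra.
  apply: leq_trans (leq_add OS near).
  apply: leq_trans (_ : #|` (O `\` Q) `|` (O `&` rball rho Q p (C / 2))| <= _)%N.
    apply/fsubset_leq_card/fsubsetP => x; rewrite !inE.
    by case: (x \in O); case: (x \in Q); case: (rho x p < C / 2).
  by rewrite cardfsU leq_subr.
- move=> s x; rewrite in_fsetU in_fsetD in_rball negb_and.
  move=> /orP[sS|/BQ[_ sp]] /andP[+ xQ]; first by move=> _; apply: sep.
  rewrite xQ /= -leNgt => xp.
  by have := rho_tri x s p; lra.
- apply/diverseP => s; rewrite inE => /orP[sS|sB].
    apply: leq_trans (dS s sS); apply: card_rball_le => x.
    by case/fsetUP => [//|/BQ[xQ _]]; rewrite ltNge sep.
  rewrite -Bk; apply/fsubset_leq_card/fsubsetP => x; rewrite in_rball inE.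
  move=> /andP[/orP[xS|->]] //; rewrite rhoC ltNge sep //.
  by have [] := BQ s sB.
Qed.

End Init.

(* If every point o of O outside A had k' points of A within C / 2, then letting
   each point of A outside O distribute a unit mass evenly among the points of
   O outside A within C / 2 of it would give mass at least 1 to each such o, so
   that A would have at least as many points as O. *)
Lemma exists_sparse_point k' C O A : 0 < C ->
  diverse rho k' C O -> (#|` A| < #|` O|)%N ->
  exists o, [/\ o \in O, o \notin A & (#|` rball rho A o (C / 2)| < k')%N].
Proof.
move=> C0 /diverseP dO AO.
have [/hasP[ o]|/hasPn dense] :=
    boolP (has (fun o => #|` rball rho A o (C / 2)| < k')%N (O `\` A)).
  by rewrite inE => /andP[oA oO] H; exists o.
exfalso; pose near x y := rho x y < C / 2.
pose w y : R := (#|` rball rho (O `\` A) y (C / 2)|%:R)^-1.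
have lower o : o \in O `\` A -> 1 <= \sum_(y <- A `\` O | near y o) w y.
  move=> oOA; have := dense o oOA; rewrite -leqNgt.
  have [oO oA] : o \in O /\ o \notin A by move: oOA; rewrite inE => /andP[].
  set j := #|` rball rho (O `&` A) o (C / 2)|.
  (* The points of O near y and those near o all lie within C of o; so y shares its mass among at
     most k' - j points. *)
  have jk y : near y o -> (#|` rball rho (O `\` A) y (C / 2)| + j <= k')%N.
    rewrite /near => yo; apply: leq_trans (dO o oO).
    rewrite -cardfsUI (_ : rball _ _ _ _ `&` _ = fset0) ?cardfs0 ?addn0; last first.
      by apply/fsetP => x; rewrite !inE; case: (x \in A); rewrite ?andbF.
    apply/fsubset_leq_card/fsubsetP => x; rewrite !inE.
    case/orP => /andP[/andP[]].
      by move=> _ -> xy /=; have := rho_tri x y o; lra.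
    by move=> -> _ xo /=; lra.
  have deg0 y : near y o -> (0 < #|` rball rho (O `\` A) y (C / 2)|)%N.
    by move=> yo; rewrite cardfs_gt0; apply/fset0Pn; exists o; rewrite in_rball oOA rhoC.
  have oo : near o o by rewrite /near rho_xx divr_gt0.
  have jk' : (j < k')%N by have := jk o oo; have := deg0 o oo; lia.
  move=> kA.
  (* Of the at least k' points of A near o, exactly j lie in O; each of the others gives o at least
     1 / (k' - j). *)
  have cnt : (k' - j <= count (near^~ o) (A `\` O))%N.
    rewrite leq_subLR; apply: leq_trans kA _; rewrite -card_rball.
    apply: leq_trans (_ : #|` rball rho (O `&` A) o (C / 2) `|`
        rball rho (A `\` O) o (C / 2)| <= _)%N.
      apply/fsubset_leq_card/fsubsetP => x; rewrite !inE.
      by case: (x \in A); case: (x \in O); case: (rho x o < C / 2).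
    by rewrite cardfsU leq_subr.
  apply: le_trans (_ : \sum_(y <- A `\` O | near y o) (k' - j)%:R^-1 <= _); last first.
    apply: ler_sum => y yo; rewrite /w lef_pV2 ?posrE ?ltr0n ?subn_gt0 ?deg0 //.
    by rewrite ler_nat leq_subRL ?(ltnW jk') // addnC jk.
  rewrite big_const_seq iter_addr_0 -[leRHS]mulr_natl ler_pdivlMr ?ltr0n ?subn_gt0 //.
  by rewrite mul1r ler_nat.
have : #|` O `\` A|%:R <= #|` A `\` O|%:R :> R.
  apply: le_trans (_ : \sum_(o <- O `\` A) \sum_(y <- A `\` O | near y o) w y <= _).
    rewrite -sum1_size natr_sum big_seq [leRHS]big_seq.
    by apply: ler_sum => o /lower.
  (* Summed over y first, the mass given away by each y is 1, or 0 if no point of O outside A is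
     near it. *)
  rewrite (exchange_big_dep predT) //= -sum1_size natr_sum.
  apply: ler_sum => y _.
  rewrite big_const_seq iter_addr_0 -[leLHS]mulr_natl /w card_rball.
  under eq_count => x do rewrite /near rhoC.
  by case: (count _ _) => [|n]; rewrite ?mul0r // divff.
rewrite ler_nat; have := cardfsID A O; have := cardfsID O A.
by rewrite [A `&` O]fsetIC; lia.
Qed.

(** A point within C/12 of v sees, besides v, only points of A within C/6 of v, which are fewer than
    k'. The balls of all other points do not contain v. *)
Lemma diverse_add k' C A v : 0 < C ->
  diverse rho k' (C / 12) A -> (#|` rball rho A v (C / 6)| < k')%N ->
  diverse rho k' (C / 12) (v |` A).
Proof.
move=> C0 /diverseP dA sparse; apply/diverseP => p pv.
have [vp|vp] := ltP (rho v p) (C / 12).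
  apply: leq_trans (_ : #|` v |` rball rho A v (C / 6)| <= _)%N.
    apply/fsubset_leq_card/fsubsetP => x; rewrite !inE => /andP[].
    case/orP => [->//|-> xp]; apply/orP; right => /=.
    by have := rho_tri x p v; rewrite (rhoC p v); lra.
  by apply: leq_trans sparse; rewrite cardfsU1; exact: leq_add (leq_b1 _) (leqnn _).
have pA : p \in A.
  by case/fset1UP: pv vp => [->|//]; rewrite rho_xx; lra.
apply: leq_trans (dA p pA); apply: card_rball_le => x.
by case/fset1UP => [->|//]; rewrite ltNge vp.
Qed.

(** A representative within C/3 of z inherits its sparsity, since C/6 + C/3 = C/2. Otherwise z was
    not picked, so the bag was not exhausted and there are ceil(k/k') picks at pairwise distance at
    least C/3. If the disjoint balls of radius C/6 around them all had k' points of A, then A would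
    have at least k points. *)
Lemma rep_sparse k k' C A z bag rep : 0 < C -> (0 < k')%N ->
  (#|` A| < k)%N -> (#|` rball rho A z (C / 2)| < k')%N ->
  uniq bag -> z \in bag ->
  gonzalez rho bag (minn (ceil_div k k') (size bag)) rep ->
  exists2 v, v \in rep & (#|` rball rho A v (C / 6)| < k')%N.
Proof.
move=> C0 k0 Ak sparse ubag zbag grep.
have [/hasP[v vrep zv]|/hasPn far] := boolP (has (fun v => rho z v < C / 3) rep).
  exists v => //; apply: leq_ltn_trans sparse.
  apply: card_rball_le => x xA xv; split=> //.
  by have := rho_tri x v z; rewrite (rhoC v z); lra.
have {}far v : v \in rep -> C / 3 <= rho z v by move=> /far; rewrite -leNgt.
have zrep : z \notin rep.
  by apply/negP => /far; rewrite rho_xx; lra.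
have szrep : size rep = ceil_div k k'.
  rewrite (gonzalez_size grep); apply/minn_idPl; rewrite leqNgt; apply/negP => szb.
  case/negP: zrep; apply: (gonzalez_full grep) => //.
  by apply/esym/minn_idPr; apply: ltnW.
have pw := gonzalez_separated rhoP grep zbag far zrep.
have [/hasP[v vr vs]|/hasPn dense] :=
    boolP (has (fun v => #|` rball rho A v (C / 6)| < k')%N rep).
  by exists v.
exfalso; have : (k <= #|` A|)%N; last by rewrite leqNgt Ak.
apply: leq_trans (ceil_div_mul k k0) _; rewrite -szrep.
apply: leq_trans (_ : \sum_(v <- rep) \sum_(y <- A | (rho y v < C / 6)%R) 1 <= _)%N.
  rewrite -sum1_size big_distrl /= big_seq [X in (_ <= X)%N]big_seq.
  apply: leq_sum => v vrep; rewrite mul1n sum1_count -card_rball.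
  by have := dense v vrep; rewrite -leqNgt.
(* By disjointness of the balls, each y is counted for at most one representative. *)
rewrite (exchange_big_dep predT) //= -[leqRHS]sum1_size; apply: leq_sum => y _.
rewrite sum1_count.
elim: rep pw {grep far zrep szrep dense} => //= v s IH /andP[/allP vs ps].
case yv: (rho y v < C / 6); last exact: IH.
rewrite addnC addn1 ltnS leqNgt -has_count; apply/hasPn => x xs.
rewrite -leNgt; have := vs x xs; have := rho_tri v y x; rewrite (rhoC v y); lra.
Qed.

End Diversity.

(** * The search *)

Section SearchCorrect.
Context {R : realType} {X : metricType R}.
Variables (rho : X -> X -> R) (k k' : nat) (C alpha : R).
Variables (P : {fset X}) (G : X -> seq X) (q : X).
Hypotheses (rhoP : pseudometric rho) (k'0 : (0 < k')%N) (k'k : (k' <= k)%N).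
Hypotheses (a1 : 1 < alpha) (C0 : 0 < C).
Hypothesis idx : diverse_index rho k k' alpha P G.
Implicit Types (p u v w x y z : X) (A B O : {fset X}) (s : seq X) (r m : R).

Let k0 : (0 < k)%N. Proof. exact: leq_trans k'k. Qed.
Let a0 : 0 < alpha. Proof. exact: lt_trans a1. Qed.

Lemma mem_index p v : p \in P -> v \in G p -> v \in P.
Proof.
by move=> /idx[L [LP _ /bag_loop_sub GL]] /GL; rewrite (perm_mem LP).
Qed.

Definition valid A := [/\ A `<=` P, #|` A| = k & diverse rho k' (C / 12) A].

Lemma init_exists : exists o, init rho k k' C P o.
Proof.
have [F HF] := init_loop_exists rhoP k' C0 P fset0.
case: (leqP k #|` F|) => [kF|Fk].
  have [S SF Sk] := fset_take kF.
  by exists (Some S), F => //; rewrite kF; exists S.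
by exists None, F => //; rewrite leqNgt Fk.
Qed.

(** The set O rules out the answer [None], because the loop collects at least as many points as O
    has. Diversity at radius C/4 is then weakened to C/12. *)
Lemma init_valid O o : O `<=` P -> #|` O| = k -> diverse rho k' C O ->
  init rho k k' C P o -> exists2 A, o = Some A & valid A.
Proof.
move=> OP Ok dO [F HF].
have [|||dF] := init_loop_spec rhoP C0 HF dO.
- by rewrite leqn0 cardfs_eq0 fsetD_eq0.
- by move=> s x; rewrite inE.
- by apply/diverseP => p; rewrite inE.
rewrite Ok => -> [S [SF Sk ->]]; exists S => //; split=> //.
  apply: fsubset_trans SF _; have := init_loop_sub HF.
  by rewrite fset0U.
by apply: diverse_sub SF _ dF; rewrite ler_pM2l // lef_pV2 ?posrE // ler_nat.
Qed.

Definition admissible A u := (u \notin A) && diverse rho k' (C / 12) (u |` A).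

Lemma fill_full A s : (k <= #|` A|)%N -> fill rho k k' C A s = A.
Proof. by case: s => [|u s] /= ->. Qed.

(** With one point missing, the loop stops at the first point it really adds; a point already in A
    leaves A unchanged, which is why [admissible] excludes it. *)
Lemma fill_first A s : #|` A|.+1 = k ->
  fill rho k k' C A s =
  if [seq u <- s | admissible A u] is u :: _ then u |` A else A.
Proof.
move=> Ak; elim: s => [|u s IH] /=; rewrite -{1}Ak ltnn // /admissible.
have [uA|uA] := boolP (u \in A); first by rewrite /= mem_fset1U // if_same.
by case: ifP => //= _; rewrite fill_full // cardfsU1 uA add1n Ak.
Qed.

Lemma step_exists A : #|` A| = k -> exists B, step rho k k' C G q A B.
Proof.
move=> Ak; have /fset0Pn[a aA] : A != fset0 by rewrite -cardfs_gt0 Ak.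
have [x xA xmax] := seq_argmin (fun y => - mdist y q) aA.
pose s := sort (fun x y => mdist x q <= mdist y q)
  (undup (A ++ flatten [seq G p | p <- A])).
exists (fill rho k k' C (A `\ x) s), (A `\ x), s; split=> //.
- split; first exact: fsubD1set.
    by rewrite -Ak (cardfsD1 x A) xA.
  move=> y z; rewrite !inE => /andP[_ yA] /andP[+ zA].
  rewrite zA andbT negbK => /eqP ->.
  by have := xmax y yA; rewrite lerN2.
- by rewrite perm_sort.
- by apply: sort_sorted => y z; apply: le_total.
Qed.

Definition candidate A v := v \in A ++ flatten [seq G p | p <- A].

Lemma candidateP A v :
  candidate A v <-> v \in A \/ exists2 p, p \in A & v \in G p.
Proof.
rewrite /candidate mem_cat; split.
  case/orP => [->|/flatten_mapP[p pA vp]]; first by left.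
  by right; exists p.
by case=> [->//|[p pA vp]]; apply/orP; right; apply/flatten_mapP; exists p.
Qed.

(** Keeping the k - 1 closest points drops a single farthest point x. As x itself may be added back,
    the loop always finds some w, and w is closest because the candidates are sorted. *)
Lemma step_replaces A B : #|` A| = k -> diverse rho k' (C / 12) A ->
  step rho k k' C G q A B ->
  exists x w, [/\ x \in A, forall y, y \in A -> mdist y q <= mdist x q,
    B = w |` (A `\ x), candidate A w /\ admissible (A `\ x) w
    & forall v, candidate A v -> admissible (A `\ x) v -> mdist w q <= mdist v q].
Proof.
move=> Ak dA [A' [s [[A'A A'k A'min] sU ssort ->]]].
have /cardfs1P[x xE] : #|` A `\` A'| == 1%N.
  by rewrite cardfsDS // Ak A'k; apply/eqP; lia.
have xA : x \in A.
  have : x \in A `\` A' by rewrite xE inE.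
  by rewrite inE => /andP[].
have A'E : A' = A `\ x by rewrite -xE fsetDK.
have adx : admissible A' x.
  by rewrite /admissible A'E !inE eqxx /= fsetD1K.
have sE v : (v \in s) = candidate A v by rewrite (perm_mem sU) mem_undup.
have cx : candidate A x by apply/candidateP; left.
have tr : transitive (fun x y : X => mdist x q <= mdist y q).
  by move=> y t z; apply: le_trans.
rewrite fill_first; last by rewrite A'k prednK.
have fE v : (v \in [seq u <- s | admissible A' u]) = admissible A' v && candidate A v.
  by rewrite mem_filter sE.
have := sorted_filter tr (admissible A') ssort.
case: [seq u <- s | admissible A' u] fE => [|w t] fE fsort.
  by have := fE x; rewrite adx cx.
exists x, w; split=> //.
- move=> y yA; have [->//|yx] := eqVneq y x.
  by apply: A'min; [rewrite A'E !inE yx|rewrite xE !inE].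
- by rewrite A'E.
- by have := fE w; rewrite mem_head A'E => /esym/andP[].
- move=> v cv; rewrite -A'E => av; have := fE v; rewrite av cv inE => /predU1P[->//|vt].
  by have := order_path_min tr fsort => /allP/(_ v vt).
Qed.

Lemma step_valid A B : valid A -> step rho k k' C G q A B -> valid B.
Proof.
move=> [AP Ak dA] /(step_replaces Ak dA)[x [w [xA _ -> [cw /andP[wA dw]] _]]].
split=> //; last by rewrite cardfsU1 wA -Ak (cardfsD1 x A) xA.
rewrite fsubUset fsub1set (fsubset_trans (fsubD1set _ _) AP) andbT.
case/candidateP: cw => [wA'|[p pA wp]]; first exact: (fsubsetP AP).
by apply: mem_index wp; apply: (fsubsetP AP).
Qed.

Lemma search_valid O T o : O `<=` P -> #|` O| = k -> diverse rho k' C O ->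
  search rho k k' C P G q T o -> exists2 A, o = Some A & valid A.
Proof.
move=> OP Ok dO; elim=> {T o} [ o|T A B _ [_ [<-] vA] sAB|T _ [A] //].
  exact: init_valid dO.
by exists B => //; apply: step_valid sAB.
Qed.

Lemma search_exists O T : O `<=` P -> #|` O| = k -> diverse rho k' C O ->
  exists o, search rho k k' C P G q T o.
Proof.
move=> OP Ok dO; elim: T => [|T [ o so]].
  by have [ o io] := init_exists; exists o; apply: search_init.
have [A oA [_ Ak _]] := search_valid OP Ok dO so; rewrite oA in so.
by have [B sB] := step_exists Ak; exists (Some B); apply: search_step sB.
Qed.

Lemma better_neighbour A O x r m : valid A ->
  #|` O| = k -> O `<=` P -> diverse rho k' C O ->
  (forall o, o \in O -> mdist o q <= r) ->
  x \in A -> (forall y, y \in A -> mdist y q <= m) -> r < mdist x q ->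
  exists v, [/\ candidate A v, admissible (A `\ x) v
    & mdist v q <= (m + r) / alpha + r].
Proof.
move=> [AP Ak dA] Ok OP dO Or xA Am rx.
have A'k : (#|` A `\ x| < #|` O|)%N by rewrite Ok -Ak (cardfsD1 x A) xA.
have [z [zO zA' sparse]] := exists_sparse_point rhoP C0 dO A'k.
(* Within A, z could only be the dropped x, which is farther from q than every point of O. *)
have zA : z \notin A.
  apply/negP => zA; move: zA'; rewrite !inE zA andbT negbK => /eqP zx.
  by have := Or z zO; rewrite zx leNgt rx.
have [p pA pmin] := seq_argmin (fun y => mdist y z) xA.
have pP : p \in P by apply: (fsubsetP AP).
have [L [LP sL loop]] := idx pP.
have uL : uniq L by rewrite (perm_uniq LP) fset_uniq.
have zL : z \in L by rewrite (perm_mem LP) (fsubsetP OP).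
have [u [bag [rep [[upz ubag zbag] [bagu grep repG]]]]] :=
  bag_loop_bag a0 loop uL sL zL.
rewrite Ok in A'k.
have [v vrep vsparse] := rep_sparse rhoP C0 k'0 A'k sparse ubag zbag grep.
(* Both v and z are within D(p, u) / (2 alpha) of the bag centre u, and u is no farther from p than
   z. *)
have vz : mdist v z <= mdist p z / alpha.
  have uv := bagu v (gonzalez_sub grep vrep); have uz := bagu z zbag.
  apply: le_trans (metric_triangle v u z) _; rewrite (metric_sym v u).
  apply: le_trans (lerD uv uz) _.
  rewrite (_ : _ + _ = mdist p u / alpha); last by field; rewrite gt_eqF.
  by rewrite ler_pM2r ?invr_gt0.
have pz0 : 0 < mdist p z by rewrite mdist_gt0; apply: contraNneq zA => <-.
(* As alpha > 1, v is strictly closer to z than p, a closest point of A. *)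
have vA : v \notin A.
  apply/negP => /pmin; rewrite leNgt => /negP; apply; apply: le_lt_trans vz _.
  by rewrite ltr_pdivrMr // ltr_pMr.
exists v; split.
- by apply/candidateP; right; exists p => //; apply: repG.
- rewrite /admissible !inE (negbTE vA) andbF /=; apply: diverse_add => //.
  by apply: diverse_sub dA; rewrite ?fsubD1set.
- apply: le_trans (metric_triangle v z q) _; apply: lerD (Or z zO).
  apply: le_trans vz _; rewrite ler_pM2r ?invr_gt0 //.
  apply: le_trans (metric_triangle p q z) _.
  by rewrite lerD ?Am // metric_sym Or.
Qed.

Lemma search_step_inv T B : search rho k k' C P G q T.+1 (Some B) ->
  exists A, search rho k k' C P G q T (Some A) /\ step rho k k' C G q A B.
Proof. by move=> sB; inversion sB as [|T' A B' sA sAB|]; exists A. Qed.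

(** * Progress in rounds of k steps *)

Section Rounds.
Variables (O : {fset X}) (r : R).
Hypotheses (Ok : #|` O| = k) (OP : O `<=` P) (dO : diverse rho k' C O).
Hypothesis Or : forall o, o \in O -> mdist o q <= r.

(** If the farthest point x exceeds the new bound, then it exceeds r as well, and [better_neighbour]
    makes its replacement obey the new bound: one far point less. If x obeys the bound, no far point
    is left and none is created. *)
Lemma step_progress A B m : valid A -> 0 <= r ->
  (forall y, y \in A -> mdist y q <= m) -> step rho k k' C G q A B ->
  (forall y, y \in B -> mdist y q <= m) /\
  (count (fun y => (m + r) / alpha + r < mdist y q)%R B <=
   (count (fun y => (m + r) / alpha + r < mdist y q)%R A).-1)%N.
Proof.
move=> vA r0 Am sAB; have [AP Ak dA] := vA.
have [x [w [xA xmax -> [cw aw] wmin]]] := step_replaces Ak dA sAB.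
have wx : mdist w q <= mdist x q.
  apply: wmin; first by apply/candidateP; left.
  by rewrite /admissible !inE eqxx /= fsetD1K.
split.
  move=> y /fset1UP[->|]; first exact: le_trans (Am x xA).
  by rewrite !inE => /andP[_ /Am].
set t := (m + r) / alpha + r; set f := fun y => t < mdist y q.
have [wA _] := andP aw.
have cB : count f (w |` (A `\ x)) = (f w + count f (A `\ x))%N.
  by rewrite (permP (perm_fset1U wA)).
have cA : count f A = (f x + count f (A `\ x))%N.
  rewrite -{1}(fsetD1K xA) (permP (perm_fset1U _)) //.
  by rewrite !inE eqxx.
have fx0 : ~~ f x -> count f A = 0%N.
  rewrite -leNgt => xt; apply/eqP; rewrite -leqn0 leqNgt -has_count.
  by apply/hasPn => y yA; rewrite -leNgt; apply: le_trans (xmax y yA) xt.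
have wt : f x -> ~~ f w.
  move=> fx; rewrite -leNgt.
  have rt : r < mdist x q.
    apply: le_lt_trans fx; rewrite /t lerDr divr_ge0 ?(ltW a0) // addr_ge0 //.
    exact: le_trans (mdist_ge0 x q) (Am x xA).
  have [v [cv av vt]] := better_neighbour vA Ok OP dO Or xA Am rt.
  by apply: le_trans vt; apply: wmin.
rewrite cB; case fx: (f x).
  by rewrite (negbTE (wt fx)) cA fx.
have fw : f w = false.
  by apply/negbTE; rewrite -leNgt (le_trans wx) // leNgt; apply: negbT fx.
by move: cA; rewrite fx0 ?fx // fw !add0n => <-.
Qed.

(** The excess over the fixed point of m -> (m + r) / alpha + r is divided by alpha in each round.
    It is at most Dmax initially, by the triangle inequality through a point of O. *)
Lemma search_bound i T A y : 0 <= r -> search rho k k' C P G q T (Some A) ->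
  (k * i <= T)%N -> y \in A ->
  mdist y q <= (alpha + 1) / (alpha - 1) * r + Dmax P / alpha ^+ i.
Proof.
move=> r0; elim: i T A y => [|i IH] T A y sA kT yA.
  have [_ [<-] [AP _ _]] := search_valid OP Ok dO sA.
  have /fset0Pn[z zO] : O != fset0 by rewrite -cardfs_gt0 Ok.
  have yP := fsubsetP AP _ yA; have zP := fsubsetP OP _ zO.
  rewrite expr0 divr1 addrC.
  apply: le_trans (metric_triangle y z q) _; apply: lerD; first exact: mdist_le_Dmax.
  apply: le_trans (Or zO) _; rewrite ler_peMl // ler_pdivlMr ?subr_gt0 //.
  lra.
set m := (alpha + 1) / (alpha - 1) * r + Dmax P / alpha ^+ i.
have -> : (alpha + 1) / (alpha - 1) * r + Dmax P / alpha ^+ i.+1 = (m + r) / alpha + r.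
  rewrite /m exprS; field.
  rewrite expf_neq0 ?(gt_eqF a0) //=; rewrite gt_eqF ?subr_gt0 //.
(* Within a round, j steps leave at most k - j points beyond the new bound. *)
have count_far j B : search rho k k' C P G q (k * i + j) (Some B) ->
    (count (fun y => (m + r) / alpha + r < mdist y q)%R B <= k - j)%N.
  elim: j B => [|j IHj] B sB.
    have [_ [<-] [_ Bk _]] := search_valid OP Ok dO sB.
    by rewrite subn0 -Bk count_size.
  rewrite addnS in sB; have [A' [sA' stp]] := search_step_inv sB.
  have [_ [<-] vA'] := search_valid OP Ok dO sA'.
  have Am z : z \in A' -> mdist z q <= m by apply: IH sA' _; rewrite leq_addr.
  have [_ /leq_trans] := step_progress vA' r0 Am stp; apply.
  by rewrite subnS -!subn1 leq_sub2r // IHj.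
have kTi : (k * i + (T - k * i) = T)%N by move: kT; rewrite mulnS; lia.
rewrite -kTi in sA; have := count_far _ _ sA.
rewrite (_ : k - _ = 0)%N; last by move: kT; rewrite mulnS; lia.
by rewrite leqNgt -has_count => /hasPn/(_ y yA); rewrite -leNgt.
Qed.

End Rounds.

End SearchCorrect.

(** * Number of steps needed for the approximation ratio *)

Section Convergence.
Context {R : realType} {X : metricType R}.
Implicit Types (P S : {fset X}) (q y : X).

Lemma max_dist_le q S r : 0 <= r -> (forall y, y \in S -> mdist y q <= r) ->
  max_dist q S <= r.
Proof. by move=> r0 Sr; rewrite /max_dist big_seq; apply: bigmax_le. Qed.

Lemma mdist_le_max_dist q S y : y \in S -> mdist y q <= max_dist q S.
Proof. by move=> yS; apply: (le_bigmax_seq _ _ _ (fun p => mdist p q) yS isT). Qed.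

Lemma max_dist_ge0 q S : 0 <= max_dist q S.
Proof. exact: bigmax_ge_id. Qed.

(** Take i just above log_alpha (K M) with M = max(2, x). Since ln 2 <= ln M, the part ln K / ln
    alpha is at most (ln K / ln 2) [olog alpha x]; the part of M and the rounding account for the
    summand 2. *)
Lemma exists_rounds (alpha K x c : R) (k T : nat) : 1 < alpha -> 1 <= K ->
  (ln K / ln 2 + 2) <= c -> c * k%:R * olog alpha x <= T%:R ->
  exists2 i : nat, (k * i <= T)%N & K * Num.max 2 x <= alpha ^+ i.
Proof.
move=> a1 K1 Kc cT; set M := Num.max 2 x.
have M2 : 2 <= M by rewrite le_max lexx.
have L0 := @ln2_gt0 R; have la0 : 0 < ln alpha by apply: ln_gt0.
have KM1 : 1 <= K * M by nra.
have [i [Mi iM]] := exists_expr_gt a1 KM1.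
exists i; last exact: ltW.
have o1 := olog_ge1 alpha x.
have hM := ln_max2_ge x a1; rewrite -/M in hM.
have ln2M : ln 2 <= ln M by rewrite ler_ln ?posrE //; lra.
have i_le : i%:R <= c * olog alpha x.
  have K0 : 0 < K by lra.
  have M0 : 0 < M by lra.
  apply: (le_trans iM); rewrite lnM ?posrE // mulrDl.
  have lnK0 : 0 <= ln K / ln 2 by rewrite divr_ge0 ?ln_ge0 ?ler1n.
  have q1 : ln M / ln alpha <= olog alpha x by rewrite ler_pdivrMr // mulrC.
  have q2 : ln K / ln alpha <= ln K / ln 2 * olog alpha x.
    rewrite ler_pdivrMr //.
    apply: le_trans (_ : ln K / ln 2 * ln 2 <= _); first by rewrite divfK ?gt_eqF.
    by rewrite -[leRHS]mulrA ler_wpM2l // [leRHS]mulrC; lra.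
  have := ler_wpM2r (le_trans ler01 o1) Kc; lra.
rewrite -(ler_nat R) natrM; apply: le_trans cT.
by rewrite mulrAC [leRHS]mulrC ler_wpM2l.
Qed.

Lemma search_converges (rho : X -> X -> R) (alpha0 eps0 : R) P
    k k' alpha eps C (G : X -> seq X) q O T ALG :
  1 < alpha0 -> 0 < eps0 -> pseudometric rho ->
  (0 < k')%N -> (k' <= k)%N -> 1 < alpha -> 0 < eps -> 0 < C ->
  diverse_index rho k k' alpha P G ->
  O `<=` P -> #|` O| = k -> diverse rho k' C O ->
  search rho k k' C P G q T (Some ALG) ->
  (2 <= k)%N \/ (alpha0 <= alpha /\ eps <= eps0) ->
  let K := 2 + 4 * ((alpha0 + 1) / (alpha0 - 1)) + 4 * eps0 in
  (ln K / ln 2 + 2) * k%:R * olog alpha (aspect_ratio P / eps) <= T%:R ->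
  max_dist q ALG <= ((alpha + 1) / (alpha - 1) + eps) * max_dist q O.
Proof.
move=> a01 e00 rhoP k'0 k'k a1 e0 C0 idx OP Ok dO sA hyp K cT.
set beta := (alpha + 1) / (alpha - 1); set beta0 := (alpha0 + 1) / (alpha0 - 1).
have KE : K = 2 + 4 * beta0 + 4 * eps0 by [].
clearbody K.
set r := max_dist q O; have r0 : 0 <= r := max_dist_ge0 q O.
have beta1 : 1 <= beta by rewrite ler_pdivlMr ?subr_gt0 //; lra.
have beta01 : 1 <= beta0 by rewrite ler_pdivlMr ?subr_gt0 //; lra.
have K1 : 1 <= K by lra.
have [i kiT KM] := exists_rounds a1 K1 (lexx _) cT.
set M := Num.max 2 _ in KM.
have M2 : 2 <= M by rewrite le_max lexx.
have Or z : z \in O -> mdist z q <= r by apply: mdist_le_max_dist.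
have bound0 : 0 <= (beta + eps) * r by rewrite mulr_ge0 //; lra.
apply: max_dist_le => // y yA.
have [yO|yO] := boolP (y \in O).
  by apply: le_trans (Or y yO) _; rewrite ler_peMl //; lra.
have k0 : (0 < k)%N by apply: leq_trans k'k.
have /fset0Pn[z zO] : O != fset0 by rewrite -cardfs_gt0 Ok.
have [_ [<-] [AP _ _]] := search_valid rhoP k'0 k'k a1 C0 idx OP Ok dO sA.
have yP := fsubsetP AP _ yA; have zP := fsubsetP OP _ zO.
have yz : y != z by apply: contraNneq yO => ->.
have D0 := Dmin_gt0 yP zP yz.
have Dyq := search_bound rhoP k'0 k'k a1 C0 idx Ok OP dO Or r0 sA kiT yA.
rewrite -/beta in Dyq.
have DeltaM : aspect_ratio P <= eps * M.
  by rewrite mulrC -ler_pdivrMr // le_max lexx orbT.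
have DmaxE : Dmax P = aspect_ratio P * Dmin P by rewrite divfK // gt_eqF.
have ai0 : 0 < alpha ^+ i by rewrite exprn_gt0 //; lra.
(* Since alpha^i >= K M and Delta <= eps M, the remaining excess Dmax / alpha^i is at most eps Dmin
   / K, hence at most eps r. *)
have large_r : Dmin P <= K * r -> mdist y q <= (beta + eps) * r.
  move=> Dr; apply: le_trans Dyq _; rewrite mulrDl lerD2l ler_pdivrMr // DmaxE.
  apply: le_trans (ler_wpM2r (ltW D0) DeltaM) _.
  rewrite -!mulrA ler_pM2l //.
  apply: le_trans (_ : M * (K * r) <= _); first by rewrite ler_pM2l //; lra.
  by rewrite mulrA (mulrC M) (mulrC r) ler_wpM2r.
case: (lerP (Dmin P) (K * r)) => [/large_r//|rD].
case: hyp => [k2|[aa ee]].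
  apply: large_r.
  (* Two distinct points of O within r of q give Dmin <= 2 r, and 2 <= K. *)
  have /fset0Pn[t] : O `\ z != fset0.
    by move: k2; rewrite -cardfs_gt0 -Ok (cardfsD1 z O) zO.
  rewrite !inE => /andP[tz tO].
  have := Dmin_le_mdist (fsubsetP OP _ tO) zP tz.
  have := metric_triangle t q z; have := Or t tO; have := Or z zO.
  rewrite (metric_sym q z); nra.
(* Here K r < Dmin, and the terms of K make each of beta r, r and Dmax / alpha^i at most Dmin / 4.
   Then y and z would be closer than Dmin, although distinct. *)
have beta_le : beta <= beta0.
  rewrite ler_pdivrMr ?subr_gt0 // mulrAC ler_pdivlMr ?subr_gt0 //; nra.
have DmaxD : Dmax P / alpha ^+ i <= Dmin P / 4.
  rewrite ler_pdivrMr // DmaxE.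
  have : aspect_ratio P <= eps0 * M.
    by apply: le_trans DeltaM _; rewrite ler_pM2r //; lra.
  have : 4 * eps0 * M <= alpha ^+ i by apply: le_trans KM; rewrite ler_pM2r; lra.
  by nra.
have := Dmin_le_mdist yP zP yz.
have := metric_triangle y q z; have := Or z zO; rewrite (metric_sym q z).
move: Dyq.
have : beta * r <= Dmin P / 4.
  by nra.
have : r <= Dmin P / 4 by nra.
lra.
Qed.

End Convergence.

(** * Running time of a step *)

Section Timed.
Context {R : realType} {X : metricType R}.
Variables (rho : X -> X -> R) (k' : nat) (C : R) (G : X -> seq X) (q : X).
Hypotheses (rhoP : pseudometric rho) (C0 : 0 < C).
Implicit Types (u v w x y z : X) (s l : seq X).

Let near_count s y := count (fun x => rho x y < C / 12) s.

Lemma drop_farthestP x s : let: (l, t) := drop_farthest q x (mdist x q) s in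
  exists z, [/\ perm_eq (x :: s) (z :: l),
    forall y, y \in l -> mdist y q <= mdist z q & (t <= 3 * size s + 1)%N].
Proof.
elim: s x => [|y s IH] x /=; first by exists x.
have [xy|yx] := ltP (mdist x q) (mdist y q).
  have := IH y; case: (drop_farthest _ _ _ _) => l t [z [perm zmax tb]] /=.
  exists z; split; last by rewrite mulnS; move: tb; lia.
    apply: perm_trans (_ : perm_eq (x :: z :: l) _); first by rewrite perm_cons.
    by rewrite -(cat1s x) -(cat1s z) perm_catCA.
  move=> v; rewrite inE => /predU1P[->|/zmax//]; apply/ltW/(lt_le_trans xy).
  have : y \in z :: l by rewrite -(perm_mem perm) mem_head.
  by rewrite inE => /predU1P[->|/zmax].
have := IH x; case: (drop_farthest _ _ _ _) => l t [z [perm zmax tb]] /=.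
exists z; split; last by rewrite mulnS; move: tb; lia.
  apply: perm_trans (_ : perm_eq (y :: x :: s) _).
    by rewrite -(cat1s x) -(cat1s y) perm_catCA.
  apply: perm_trans (_ : perm_eq (y :: z :: l) _); first by rewrite perm_cons.
  by rewrite -(cat1s y) -(cat1s z) perm_catCA.
move=> v; rewrite inE => /predU1P[->|/zmax//]; apply: le_trans yx _.
have : x \in z :: l by rewrite -(perm_mem perm) mem_head.
by rewrite inE => /predU1P[->|/zmax].
Qed.

Lemma count_nearP u s : let: (n, t) := count_near rho C u s in
  n = near_count s u /\ (t <= 4 * size s + 1)%N.
Proof.
elim: s => [|y s] //=; case: (count_near _ _ _ _) => n t [-> tb] /=.
by case: (rho y u < C / 12) => /=; rewrite ?add1n ?add0n; split=> //; move: tb; lia.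
Qed.

Lemma with_countsP l s : let: (B, t) := with_counts rho C l s in
  B = [seq (y, near_count l y) | y <- s] /\
  (t <= size s * (4 * size l + 3) + 1)%N.
Proof.
elim: s => [|y s] //=; case: (with_counts _ _ _ _) => B t [-> tb] /=.
have := count_nearP y l; case: (count_near _ _ _ _) => n t' [-> tb'] /=.
by split=> //; rewrite mulSn; move: tb tb'; lia.
Qed.

(** Admissibility as the scan decides it from the stored counts. *)
Let may_add l u := [&& u \notin l,
  all (fun y => (rho y u < C / 12)%R ==> (near_count l y < k')%N) l
  & (near_count l u < k')%N].

Lemma addableP u n l s :
  let: (b, t) := addable rho k' C u n [seq (y, near_count l y) | y <- s] in
  b = [&& u \notin s,
    all (fun y => (rho y u < C / 12)%R ==> (near_count l y < k')%N) s
    & (n + near_count s u < k')%N] /\ (t <= 5 * size s + 2)%N.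
Proof.
elim: s n => [|y s IH] n /=; first by rewrite addn0.
rewrite inE negb_or eq_sym; case: eqP => [_|_] /=; first by split=> //; lia.
case: (rho y u < C / 12) => /=.
  rewrite leqNgt; case: ltnP => _ /=; last by rewrite andbF; split=> //; lia.
  have := IH n.+1; case: (addable _ _ _ _ _ _) => b t [-> tb] /=.
  by rewrite add1n addnS; split=> //; move: tb; lia.
have := IH n; case: (addable _ _ _ _ _ _) => b t [-> tb] /=.
by rewrite add0n; split=> //; move: tb; lia.
Qed.

Lemma appendP s1 s2 : append s1 s2 = (s1 ++ s2, (size s1).+1).
Proof. by elim: s1 => [|x s1 IH] //=; rewrite IH /= addn0. Qed.

Lemma gatherP s : let: (U, t) := gather G s in
  U = flatten [seq p :: G p | p <- s] /\ (t <= 3 * size U + 1)%N.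
Proof.
elim: s => [|p s] //=; case: (gather G s) => U t [-> tb] /=.
rewrite appendP /=; split=> //.
by rewrite size_cat; move: tb; lia.
Qed.

(** The comparison with an arbitrary initial [best] carries each update of the current minimum
    through the induction. *)
Lemma selectP l best U :
  (if best is Some (v, dv) then dv = mdist v q else True) ->
  let: (b, t) := select rho k' C q [seq (y, near_count l y) | y <- l] best U in
  (t <= size U * (5 * size l + 6) + 1)%N /\
  if b is Some (w, dw) then
    [/\ dw = mdist w q, best = Some (w, dw) \/ (w \in U) && may_add l w,
      forall v, v \in U -> may_add l v -> dw <= mdist v q
      & forall v dv, best = Some (v, dv) -> dw <= dv]
  else best = None /\ forall v, v \in U -> ~~ may_add l v.
Proof.
elim: U best => [|u U IH] best bestP /=.
  split=> //; case: best bestP => [[v dv]|] // bestP; split=> //; first by left.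
  by move=> _ _ [_ <-].
have := addableP u 0 l l; case: (addable _ _ _ _ _ _) => ok t [okE tb] /=.
have {}okE : ok = may_add l u by rewrite okE.
case: ok okE => /esym addu /=; last first.
  have := IH best bestP; case: (select _ _ _ _ _ _ _) => b t' /= [tb' spec].
  split; first by rewrite mulSn; move: tb tb'; lia.
  case: b spec => [[w dw]|] /=.
    case=> dwE or1 min1 min2; split=> //.
      by case: or1 => [->|/andP[wU aw]]; [left|right; rewrite inE wU orbT].
    by move=> v; rewrite inE => /predU1P[->|/min1//]; rewrite addu.
  by case=> bN nomore; split=> // v; rewrite inE => /predU1P[->|/nomore//]; rewrite addu.
case: best bestP => [[v dv]|] bestP /=; last first.
  have := IH (Some (u, mdist u q)) erefl.
  case: (select _ _ _ _ _ _ _) => b t' /= [tb' spec].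
  split; first by rewrite mulSn; move: tb tb'; lia.
  case: b spec => [[w dw]|] /=; last by case.
  case=> dwE or1 min1 min2; split=> //.
    right; rewrite inE; case: or1 => [[<- _]|/andP[-> ->]]; first by rewrite eqxx addu.
    by rewrite orbT.
  by move=> v; rewrite inE => /predU1P[-> _|/min1//]; exact: (min2 u _ erefl).
case: ltP => uv.
  have := IH (Some (u, mdist u q)) erefl.
  case: (select _ _ _ _ _ _ _) => b t' /= [tb' spec].
  split; first by rewrite mulSn; move: tb tb'; lia.
  case: b spec => [[w dw]|] /=; last by case.
  case=> dwE or1 min1 min2; split=> //.
  - right; rewrite inE; case: or1 => [[<- _]|/andP[-> ->]]; first by rewrite eqxx addu.
    by rewrite orbT.
  - by move=> v'; rewrite inE => /predU1P[-> _|/min1//]; exact: (min2 u _ erefl).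
  - by move=> _ _ [_ <-]; apply: le_trans (ltW uv); exact: (min2 u _ erefl).
have := IH (Some (v, dv)) bestP; case: (select _ _ _ _ _ _ _) => b t' /= [tb' spec].
split; first by rewrite mulSn; move: tb tb'; lia.
case: b spec => [[w dw]|] /=; last by case.
case=> dwE or1 min1 min2; split=> //.
- by case: or1 => [->|/andP[wU aw]]; [left|right; rewrite inE wU orbT].
- move=> v'; rewrite inE => /predU1P[-> _|/min1//].
  by apply: le_trans uv; exact: (min2 v dv erefl).
Qed.

Lemma perm_fset_seq (T : choiceType) (s : seq T) :
  uniq s -> perm_eq [fset x in s] s.
Proof. by move=> us; apply: uniq_perm => // x; rewrite !inE. Qed.

(** Adding u raises by one the counts of the points near u, and u also counts itself; hence the
    strict bounds. The other counts stay at most k' by diversity. *)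
Lemma may_addE l u : uniq l -> diverse rho k' (C / 12) [fset x in l] ->
  admissible rho k' C [fset x in l] u = may_add l u.
Proof.
have [rho0 rhoC _] := rhoP.
move=> ul dl; rewrite /admissible /may_add !inE; case: (boolP (u \in l)) => //= ul'.
have card_add p : #|` rball rho (u |` [fset x in l]) p (C / 12)| =
    ((rho u p < C / 12)%R + near_count l p)%N.
  rewrite card_rball (permP (perm_fset1U _)) ?inE //= (permP (perm_fset_seq ul)) //.
have dl' y : y \in l -> (near_count l y <= k')%N.
  move=> yl; have := diverseP _ _ _ _ dl y.
  by rewrite card_rball (permP (perm_fset_seq ul)) inE; apply.
apply/diverseP/andP => [H|[/allP H1 H2] p].
  split; last by have := H u; rewrite card_add rho0 divr_gt0 // add1n !inE eqxx; apply.
  apply/allP => y yl; apply/implyP => yu.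
  by have := H y; rewrite card_add rhoC yu add1n !inE yl orbT; apply.
rewrite card_add !inE => /predU1P[->|pl]; first by rewrite rho0 divr_gt0.
have := H1 p pl; rewrite rhoC; case: (rho u p < C / 12) => //= _.
by rewrite add0n dl'.
Qed.

(** The scan and a sort may treat ties differently, so a sorted order is exhibited for which [fill]
    picks the point found by the scan. *)
Lemma timed_stepP k ALG : (0 < k)%N -> uniq ALG -> size ALG = k ->
  diverse rho k' (C / 12) [fset x in ALG] ->
  let: (ALG', t) := timed_step rho k' C G q ALG in
  [/\ uniq ALG', step rho k k' C G q [fset x in ALG] [fset x in ALG']
    & (t <= 16 * (k * size (flatten [seq p :: G p | p <- ALG])))%N].
Proof.
case: ALG => [|x s] k0 uA sk dA; first by rewrite -sk in k0.
rewrite /timed_step; have := gatherP (x :: s).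
case: (gather G (x :: s)) => U t3 [UE tb3].
have := drop_farthestP x s; rewrite /=.
case: (drop_farthest _ _ _ _) => l t1 [z [perm zmax tb1]] /=.
have := with_countsP l l; case: (with_counts _ _ _ _) => B t2 [-> tb2] /=.
have := @selectP l None U I.
case: (select _ _ _ _ _ _ _) => b t4 [tb4 spec] /=.
set A := [fset y in x :: s] in dA *.
have uzl : uniq (z :: l) by rewrite -(perm_uniq perm).
have /= /andP[zl ul] := uzl.
have szl : size l = size s by have := perm_size perm => -[].
set A' := [fset y in l].
have AE : A = z |` A'.
  by apply/fsetP => y; rewrite !inE -in_cons (perm_mem perm) inE.
have Ak : #|` A| = k by rewrite -sk; apply: perm_size; apply: perm_fset_seq.
have A'k : #|` A'| = k.-1.
  by rewrite -sk /= -szl; apply: perm_size; apply: perm_fset_seq.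
have dA' : diverse rho k' (C / 12) A'.
  by apply: diverse_sub dA; rewrite // AE fsubsetU1.
have A'A : A' `<=` A by rewrite AE fsubsetU1.
have A'min y1 y2 : y1 \in A' -> y2 \in A `\` A' -> mdist y1 q <= mdist y2 q.
  rewrite AE !inE => /zmax zy1 /andP[yl].
  by rewrite (negbTE yl) orbF => /eqP ->.
(* U contains the k points of the current solution, so the quadratic cost of the counts is also O(k
   |U|). *)
have time : (1 + (t1 + (t2 + (t3 + (t4 + 0)))) <= 16 * (k * size U))%N.
  have kU : (k <= size U)%N.
    rewrite UE -sk; elim: (x :: s) => //= p s' IH'.
    by rewrite ltnS size_cat (leq_trans IH') ?leq_addl.
  have kl : (size l).+1 = k by rewrite szl.
  move: tb1 tb2 tb3 tb4 kU; rewrite -szl -kl; move: (size U) (size l) => n m.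
  by clear; nia.
have UA v : (v \in U) = candidate G A v.
  rewrite UE; apply/idP/idP => [/flatten_mapP[p ps]|].
    rewrite inE => /predU1P[->|vp]; apply/candidateP; first by left; rewrite !inE in ps *.
    by right; exists p; rewrite // !inE in ps *.
  move=> /candidateP[vA|[p pA vp]]; apply/flatten_mapP.
    by exists v; rewrite ?mem_head //; move: vA; rewrite !inE.
  by exists p; rewrite ?inE ?vp ?orbT //; move: pA; rewrite !inE.
pose D := fun x y => mdist x q <= mdist y q.
pose V := undup (A ++ flatten [seq G p | p <- A]).
have VU v : (v \in V) = (v \in U) by rewrite mem_undup UA.
have A'k1 : #|` A'|.+1 = k by rewrite A'k prednK.
case: b spec => [[w dw]|] /=.
  case=> dwE [//|/andP[wU aw]] min1 _.
  have wl : w \notin l by case/and3P: aw.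
  (* the sort used by the step breaks ties in favour of w *)
  pose r u v := (mdist u q < mdist v q) ||
    (mdist u q == mdist v q) && ((u == w) || (v != w)).
  have rtr : transitive r.
    rewrite /r => y1 y2 y3.
    case: (ltgtP (mdist y2 q) (mdist y1 q)) => //= [lt12 _|-> e12].
      case: (ltgtP (mdist y1 q) (mdist y3 q)) => //= [lt13 _|<- _].
        by rewrite (lt_trans lt12 lt13).
      by rewrite lt12.
    case: (ltgtP (mdist y1 q) (mdist y3 q)) => //= _.
    by move: e12; case: (y2 == w) => //=; case: (y1 == w).
  have rtot : total r.
    rewrite /r => y1 y2; case: (ltgtP (mdist y1 q) (mdist y2 q)) => //= _.
    by case: (y1 == w); case: (y2 == w).
  have rD : subrel r D.
    by rewrite /r /D => y1 y2 /orP[/ltW//|/andP[/eqP-> _]].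
  have sr := sort_sorted rtot V.
  split; first by rewrite /= wl.
    exists A', (sort r V); split=> //; first by rewrite perm_sort.
      exact: sub_sorted rD _ sr.
    rewrite fill_first //.
    have fE v : (v \in [seq u <- sort r V | admissible rho k' C A' u]) =
        may_add l v && (v \in U).
      by rewrite mem_filter may_addE // mem_sort VU.
    have := sorted_filter rtr (admissible rho k' C A') sr.
    case: [seq u <- _ | _] fE => [|v t] fE fsort; first by have := fE w; rewrite wU aw.
    suff -> : v = w by rewrite fset_cons.
    have := fE v; rewrite mem_head => /esym/andP[av vU].
    have := fE w; rewrite aw wU inE => /predU1P[//|wt].
    have /allP/(_ w wt) := order_path_min rtr fsort.
    have := min1 v vU av; rewrite dwE /r eqxx orbF => vw.
    by rewrite ltNge vw /= => /andP[_ /eqP].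
  by rewrite UE in time.
case=> _ none; split=> //; last by rewrite UE in time.
have Dtot : total D by move=> y1 y2; apply: le_total.
exists A', (sort D V); split=> //; first by rewrite perm_sort.
  exact: sort_sorted.
rewrite fill_first // (_ : [seq u <- _ | _] = [::]) //.
apply/eqP; rewrite -[_ == _]negbK -has_filter; apply/hasPn => v.
by rewrite mem_sort VU may_addE // => /none.
Qed.

End Timed.

(** * Sizes of adjacency lists *)

Section Sizes.
Context {R : realType} {X : metricType R}.
Variables (rho : X -> X -> R) (P : {fset X}) (d alpha : R) (k k' : nat).
Variable G : X -> seq X.
Hypotheses (dimP : doubling_dimension P d) (k'0 : (0 < k')%N) (k'k : (k' <= k)%N).
Hypotheses (a1 : 1 < alpha) (idx : diverse_index rho k k' alpha P G).

Let V := (k%:R / k'%:R) * (8 * alpha) `^ d * olog 2 (aspect_ratio P).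

(** The vertex itself counts for one, and 1 <= V turns the constant 18 into 19. *)
Lemma succ_degree_bound p : p \in P -> (size (G p)).+1%:R <= 19 * V.
Proof.
move=> pP; have d0 := doubling_dimension_ge0 dimP pP.
have := degree_bound dimP k'0 k'k a1 idx pP.
have : 1 <= V.
  have kk : 1 <= k%:R / k'%:R :> R by rewrite ler_pdivlMr ?ltr0n // mul1r ler_nat.
  have pw : 1 <= (8 * alpha) `^ d.
    by rewrite -[leLHS](powRr0 (8 * alpha)) ler_powR //; move: a1; lra.
  by rewrite /V -[leLHS]mulr1 ler_pM ?olog_ge1 // -[leLHS]mulr1 ler_pM.
rewrite -addn1 natrD /V -!mulrA; lra.
Qed.

Lemma sum_degree_bound (s : seq X) : {subset s <= P} ->
  (\sum_(p <- s) (size (G p)).+1)%:R <= (size s)%:R * (19 * V).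
Proof.
move=> sP; rewrite natr_sum mulrC mulr_natr -sum1_size -sumrMnr.
rewrite big_seq [leRHS]big_seq; apply: ler_sum => p ps.
by rewrite mulr1n; apply: succ_degree_bound; apply: sP.
Qed.

End Sizes.

(** The constant depends on [alpha0] and [eps0] alone. They matter for k = 1, where OPT_k may be far
    below Dmin and the errors are compared with Dmin instead. *)
Theorem theorem2 (R : realType) (alpha0 eps0 : R)
    (halpha0 : 1 < alpha0) (heps0 : 0 < eps0) :
  exists c : R, 0 < c /\
  forall (X : metricType R) (rho : X -> X -> R) (P : {fset X}) (d : R)
    (k k' : nat) (alpha eps C : R) (G : X -> seq X) (q : X) (OPT : {fset X}),
  pseudometric rho ->
  doubling_dimension P d ->
  (1 <= k')%N -> (k' <= k)%N -> 1 < alpha -> 0 < eps -> 0 < C ->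
  diverse_index rho k k' alpha P G ->
  optimal rho k k' C q P OPT ->
  let Delta := aspect_ratio P in
  [/\ forall T : nat,
        (exists o, search rho k k' C P G q T o) /\
        forall o, search rho k k' C P G q T o ->
        exists ALG : {fset X},
          [/\ o = Some ALG, ALG `<=` P, #|` ALG| = k,
              diverse rho k' (C / 12) ALG
            & (2 <= k)%N \/ (alpha0 <= alpha /\ eps <= eps0) ->
              c * k%:R * olog alpha (Delta / eps) <= T%:R ->
              max_dist q ALG <= ((alpha + 1) / (alpha - 1) + eps) * max_dist q OPT],
      forall (T : nat) (ALG : seq X),
        uniq ALG -> search rho k k' C P G q T (Some [fset x in ALG]) ->
        let: (ALG', time) := timed_step rho k' C G q ALG in
        [/\ uniq ALG', step rho k k' C G q [fset x in ALG] [fset x in ALG']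
          & time%:R <= c * (k%:R ^+ 3 / k'%:R) * (8 * alpha) `^ d * olog 2 Delta]
    & (graph_space P G)%:R
        <= c * #|` P|%:R * (k%:R / k'%:R) * (8 * alpha) `^ d * olog 2 Delta].
Proof.
set K := 2 + 4 * ((alpha0 + 1) / (alpha0 - 1)) + 4 * eps0.
have K1 : 1 <= K.
  have : 0 <= (alpha0 + 1) / (alpha0 - 1) by rewrite divr_ge0 //; lra.
  by rewrite /K; lra.
have c0 : 0 <= ln K / ln 2 by rewrite divr_ge0 ?ln_ge0 ?ler1n.
(* 304 = 16 * 19 serves the time of a step; it also covers the 2 of the number of rounds and the 19
   of the space. *)
set c := ln K / ln 2 + 304.
exists c; split; first by rewrite /c; lra.
move=> X rho P d k k' alpha eps C G q OPT rhoP dimP k'0 k'k a1 e0 C0 idx.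
move=> [[OP Ok dO] _] Delta.
have k0 : (0 < k)%N by apply: leq_trans k'k.
have o0 b x : 0 <= olog b x :> R := le_trans ler01 (olog_ge1 b x).
have V0 : 0 <= (k%:R / k'%:R) * (8 * alpha) `^ d * olog 2 Delta.
  by rewrite !mulr_ge0 ?powR_ge0 // ?invr_ge0 // (le_trans ler01) ?olog_ge1.
split.
- move=> T; split; first exact: (search_exists q rhoP k'0 k'k a1 C0 idx T OP Ok dO).
  move=> o so.
  have [A oA [AP Ak dA]] := search_valid rhoP k'0 k'k a1 C0 idx OP Ok dO so.
  exists A; split=> // hyp cT; rewrite oA in so.
  apply: (search_converges halpha0 heps0 rhoP k'0 k'k a1 e0 C0 idx OP Ok dO so hyp).
  apply: le_trans cT; rewrite ler_wpM2r // ler_wpM2r //.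
  by rewrite /c; lra.
- move=> T ALG uA sA.
  have [_ [<-] [AP Ak dA]] := search_valid rhoP k'0 k'k a1 C0 idx OP Ok dO sA.
  have szA : size ALG = k by rewrite -Ak card_fseq undup_id.
  have := timed_stepP G q rhoP C0 k0 uA szA dA.
  case: (timed_step _ _ _ _ _ _) => ALG' t [uA' sAA' tb]; split=> //.
  have ALGP : {subset ALG <= P} by move=> x xA; apply: (fsubsetP AP); rewrite inE.
  have := sum_degree_bound dimP k'0 k'k a1 idx ALGP.
  have -> : (\sum_(p <- ALG) (size (G p)).+1)%N =
      size (flatten [seq p :: G p | p <- ALG]).
    by rewrite size_flatten /shape -map_comp sumnE big_map.
  move: (size (flatten _)) tb => n tb nb; rewrite szA in nb.
  apply: le_trans (_ : (16 * (k * n))%:R <= _); first by rewrite ler_nat.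
  (* One factor k is the cost per scanned point, one the number of adjacency lists, and k/k' comes
     from the degree. *)
  rewrite (_ : c * _ * _ * _ =
    c * (k%:R * (k%:R * (k%:R / k'%:R * (8 * alpha) `^ d * olog 2 Delta)))); last first.
    by rewrite /GRing.exp /=; ring.
  rewrite -/Delta in nb; move: (_ * olog 2 Delta) V0 nb => V V0 nb.
  rewrite !natrM; apply: le_trans (_ : 16 * (k%:R * (k%:R * (19 * V))) <= _).
    by rewrite ler_pM2l // ler_wpM2l.
  have kV0 : 0 <= k%:R * (k%:R * V) by rewrite !mulr_ge0.
  have c304 : 304 <= c by rewrite /c; lra.
  by have := ler_wpM2r kV0 c304; lra.
- have := sum_degree_bound dimP k'0 k'k a1 idx (fun _ h => h).
  rewrite /graph_space => /le_trans; apply.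
  have nV0 : 0 <= #|` P|%:R * ((k%:R / k'%:R) * (8 * alpha) `^ d * olog 2 Delta).
    by rewrite mulr_ge0.
  have c19 : 19 <= c by rewrite /c; lra.
  have := ler_wpM2r nV0 c19; rewrite -/Delta -!mulrA.
  rewrite (mulrCA _ 19); lra.
Qed.
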